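(* Let $(S_i)_{i=1}^\infty$ be functions, each submultiplicative on $[1,\infty)$, such that for every nonempty finite $A\subset\mathbb N$ and every $j\in\mathbb N\setminus A$ one has $\sup_{n\ge1}S_j(n)/\max_{i\in A}S_i(n)=\infty$. Let $w_i(1)=1$ and $w_i(n)=S_i(n)-S_i(n-1)$ for $n\ge2$, and assume $w_i(n)\to0$ as $n\to\infty$ for each $i$ (so each $w_i$ is a submultiplicative weight sequence with fundamental function $(S_i(n))_n$). For $n\in\mathbb N$ let $X_n(1)=\big(\sum_{i=1}^n\oplus d(w_i,1)\big)_\infty$. Then $(SP_w(X_n(1)),\le)$ is order-isomorphic to $(P(n)\setminus\{\emptyset\},\subseteq)$, where $P(n)$ is the power set of $\{1,\dots,n\}$.
   Context: A function $S$ on $[1,\infty)$ is submultiplicative on $[1,\infty)$ if: (a) it is piecewise-linear, continuous, strictly increasing and concave; (b) $S(x)=x$ for $1\le x\le2$; (c) $S(xy)\le S(x)S(y)$ for all $x,y\ge1$. A weight sequence is a non-increasing positive sequence $w$ with $w(1)=1$, $w(n)\to0$, $\sum w(n)=\infty$; for $1\le p<\infty$, $d(w,p)$ is the Lorentz sequence space with basis $(e_n)$ and norm $\|\sum a_ne_n\|_{w,p}=(\sum a_n^{*p}w(n))^{1/p}$, $(a_n^* )$ the non-increasing rearrangement of $(|a_n|)$. $(\sum_{i=1}^n\oplus Y_i)_\infty$ is the direct sum with the max norm. A normalized basic sequence $(x_i)$ generates a spreading model $(\tilde x_i)$ if there exist $\varepsilon_n\downarrow0$ such that for all $n$, $(a_i)_{i=1}^n\subseteq[-1,1]$,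 $n\le k_1<\cdots<k_n$: $(1+\varepsilon_n)^{-1}\|\sum a_i\tilde x_i\|\le\|\sum a_ix_{k_i}\|\le(1+\varepsilon_n)\|\sum a_i\tilde x_i\|$. $(v_i)$ dominates $(u_i)$ if $\|\sum a_iu_i\|\le C\|\sum a_iv_i\|$ for some $C$ and all finitely supported $(a_i)$; equivalent means mutual domination. $SP_w(X)$ is the set of equivalence classes of spreading models generated by normalized weakly null sequences in $X$, ordered by $[(\tilde x_i)]\le[(\tilde y_i)]$ iff $(\tilde y_i)$ dominates $(\tilde x_i)$. *)

(* Defs.v *)
From HB Require Import structures.
From mathcomp Require Import all_boot all_order all_algebra.
From mathcomp Require Import all_classical all_reals all_analysis.
Set Implicit Arguments. Unset Strict Implicit. Unset Printing Implicit Defensive.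
Import Order.TTheory GRing.Theory Num.Theory.
Import numFieldNormedType.Exports.
Local Open Scope classical_set_scope.
Local Open Scope ring_scope.

Section Defs.
Variable R : realType.

Definition piecewise_linear1 (S : R -> R) : Prop :=
  exists t : nat -> R, t 0%N = 1 /\ (forall k, t k < t k.+1) /\
    (forall M : R, exists k, M < t k) /\
    forall k, exists a b : R, forall x, t k <= x <= t k.+1 -> S x = a * x + b.

Definition submultiplicative (S : R -> R) : Prop :=
  [/\ (* (a) *) piecewise_linear1 S,
      {within `[1, +oo[, continuous S},
      (forall x y, 1 <= x -> x < y -> S x < S y),
      (forall x y l, 1 <= x -> 1 <= y -> 0 <= l <= 1 ->
          l * S x + (1 - l) * S y <= S (l * x + (1 - l) * y)) &
      ((* (b) *) (forall x, 1 <= x <= 2 -> S x = x) /\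
       (* (c) *) (forall x y, 1 <= x -> 1 <= y -> S (x * y) <= S x * S y))].

(* weight sequence, 0-based: weight S k = w(k+1) of the paper,
   i.e. w(1) = 1, w(m) = S(m) - S(m-1) for m >= 2 *)
Definition weight (S : R -> R) (k : nat) : R :=
  if k is 0%N then 1 else S k.+1%:R - S k%:R.

(* astar a k = (k+1)-th term of the non-increasing rearrangement of |a| :
   the sup of the t such that |a j| >= t for k+1 distinct indices j *)
Definition astar (a : nat -> R) (k : nat) : \bar R :=
  ereal_sup [set t%:E | t in
    [set t : R | 0 <= t /\ exists F : seq nat,
        [/\ uniq F, size F = k.+1 & forall j, j \in F -> t <= `|a j|]]].

Definition lorentz_norm (w : nat -> R) (a : nat -> R) : \bar R :=
  \sum_(0 <= k <oo) ((w k)%:E * astar a k)%E.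

Definition E (n : nat) := 'I_n -> nat -> R.

Definition inX n (w : nat -> nat -> R) (x : E n) : Prop :=
  forall i : 'I_n, (lorentz_norm (w i) (x i) < +oo)%E.

Definition normX n (w : nat -> nat -> R) (x : E n) : R :=
  \big[Num.max/0]_(i < n) fine (lorentz_norm (w i) (x i)).

Definition comb n (a : seq R) (x : nat -> E n) (k : nat -> nat) : E n :=
  fun i j => \sum_(m < size a) a`_m * x (k m) i j.

Definition resid n (y : E n) (a : nat -> R) (x : nat -> E n) (M : nat) : E n :=
  fun i j => y i j - \sum_(m < M) a m * x m i j.

Definition bdd_functional n (w : nat -> nat -> R) (f : E n -> R) : Prop :=
  (forall (c : R) (x y : E n), inX w x -> inX w y ->
      f (fun i j => c * x i j + y i j) = c * f x + f y) /\
  exists C : R, forall x, inX w x -> `|f x| <= C * normX w x.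

Definition weakly_null n (w : nat -> nat -> R) (x : nat -> E n) : Prop :=
  forall f, bdd_functional w f -> (fun k => f (x k)) @ \oo --> (0 : R).

Definition basic n (w : nat -> nat -> R) (x : nat -> E n) : Prop :=
  forall y : E n, inX w y ->
    (forall e : R, 0 < e -> exists (M : nat) (a : nat -> R),
        normX w (resid y a x M) < e) ->
    exists! a : nat -> R, (fun M => normX w (resid y a x M)) @ \oo --> (0 : R).

Definition smnorm (V : normedModType R) (xt : nat -> V) (a : seq R) : R :=
  `| \sum_(m < size a) a`_m *: xt m |.

(* (x_k) generates the spreading model (xt_k); indices are 0-based, so
   the paper's condition n <= k_1 reads n <= k 0 + 1 *)
Definition generates_sm n (w : nat -> nat -> R) (x : nat -> E n)
    (V : normedModType R) (xt : nat -> V) : Prop :=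
  exists eps : nat -> R,
    [/\ (forall m, eps m.+1 <= eps m), eps @ \oo --> (0 : R) &
    forall (a : seq R) (k : nat -> nat),
      (forall m, (m < size a)%N -> `|a`_m| <= 1) ->
      (forall i j, (i < j < size a)%N -> (k i < k j)%N) ->
      (size a <= (k 0%N).+1)%N ->
      (1 + eps (size a))^-1 * smnorm xt a <= normX w (comb a x k) /\
      normX w (comb a x k) <= (1 + eps (size a)) * smnorm xt a].

(* N is (the norm function a |-> ||sum a_m xt_m|| of) a spreading model
   generated by a normalized weakly null (basic) sequence in X *)
Definition is_SPw n (w : nat -> nat -> R) (N : seq R -> R) : Prop :=
  exists x : nat -> E n,
    [/\ (forall k, inX w (x k)), (forall k, normX w (x k) = 1),
        basic w x, weakly_null w x &
        exists (V : normedModType R) (xt : nat -> V),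
          generates_sm w x xt /\ N = smnorm xt].

Definition dominates (Nv Nu : seq R -> R) : Prop :=
  exists C : R, forall a : seq R, Nu a <= C * Nv a.

End Defs.

(* Main.v *)
(* The Lorentz norm of [y] is the supremum of [sum_r w r * |y (g r)|] over injections
   [g], hence a lattice norm, and Abel summation together with S(cm) <= S(c) S(m) shows
   that replacing each coordinate of [a] by [c] copies multiplies its norm by at most S(c).

   To a nonempty [A] corresponds the sequence [sum_(i in A) e^i_k]: its norm is
   max_(i in A) ||a||_(w_i), it is its own spreading model, and it is weakly null because
   S_i(m) / m -> 0. Testing on constant sequences, the separation hypothesis says exactly
   that these norms are ordered by inclusion.

   Conversely let [x] be normalized and weakly null. A gliding hump argument shows that the
   tails of the decreasing rearrangements of the components of [x] are uniformly small.
   Let [A] be a minimal set such that infinitely often all components outside [A] are as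
   small as desired; the components in [A] are then bounded below, so by the uniform tails
   they have a coordinate bounded below. For fixed [m] cut the components at a small height
   [t]: only finitely many size patterns of level sets occur, so [m] terms with disjoint
   level sets and the same pattern can be chosen. The dilation bound gives
   ||sum a_l x_(k_l)|| <= 3 max_(i in A) ||a||_(w_i), and the large coordinates give the
   reverse estimate. *)
Require Import Defs.
From HB Require Import structures.
From mathcomp Require Import all_boot all_order all_algebra.
From mathcomp Require Import all_classical all_reals all_analysis.
From mathcomp Require Import zify ring lra.
Import Order.TTheory GRing.Theory Num.Theory.
Import numFieldNormedType.Exports.
Local Open Scope ring_scope.

Set Implicit Arguments. Unset Strict Implicit. Unset Printing Implicit Defensive.

(** * Weighted sums along finite lists of indices *)

Section WeightedSums.
Variable R : realType.
Implicit Types (w y z : nat -> R) (F G : seq nat).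

(** The offset [N] is the rank given to the first entry, so a concatenation splits the sum without
    changing the weights. A duplicate-free list is a finite piece of an injection from ranks to
    indices. *)
Fixpoint wsum w y (N : nat) F : R :=
  if F is j :: F' then w N * `|y j| + wsum w y N.+1 F' else 0.

(** For a decreasing weight this is the fundamental function, the norm of a sum of [N] distinct unit
    vectors. *)
Definition wpart w (N : nat) : R := \sum_(i < N) w i.

Record decreasing_weight w : Prop := DecreasingWeight {
  weight0 : w 0%N = 1;
  weight_ge0 : forall k, 0 <= w k;
  weightS_le : forall k, w k.+1 <= w k }.

Lemma wsum_cat w y N F G :
  wsum w y N (F ++ G) = wsum w y N F + wsum w y (N + size F) G.
Proof.
elim: F N => [|j F IH] N /=; first by rewrite add0r addn0.
by rewrite IH addrA addSnnS.
Qed.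

Lemma wsumE w y N F :
  wsum w y N F = \sum_(i < size F) w (N + i)%N * `|y (nth 0%N F i)|.
Proof.
elim: F N => [|j F IH] N /=; first by rewrite big_ord0.
rewrite big_ord_recl /= addn0 IH; congr (_ + _).
by apply: eq_bigr => i _; rewrite /bump /= add1n addSnnS.
Qed.

Lemma wsum_map w y N (g : nat -> nat) F :
  wsum w y N (map g F) = wsum w (y \o g) N F.
Proof. by elim: F N => //= j F IH N; rewrite IH. Qed.

Lemma eq_wsum w y z N F : {in F, forall j, y j = z j} ->
  wsum w y N F = wsum w z N F.
Proof.
elim: F N => //= j F IH N h; rewrite h ?mem_head//; congr (_ + _); apply: IH => k kF.
by apply: h; rewrite inE kF orbT.
Qed.

Lemma wsumZ w y N F (c : R) : wsum w (fun j => c * y j) N F = `|c| * wsum w y N F.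
Proof.
elim: F N => [|j F IH] N /=; first by rewrite mulr0.
by rewrite IH normrM mulrDr mulrCA.
Qed.

Lemma wsum_iota w y N M (g : nat -> nat) :
  wsum w y N (map g (iota N M)) = \sum_(N <= r < N + M) w r * `|y (g r)|.
Proof.
elim: M N => [|M IH] N /=; first by rewrite addn0 big_geq.
by rewrite IH addnS addSn [RHS]big_nat_recl ?leq_addr// [in LHS]big_add1.
Qed.

Lemma wpartS w N : wpart w N.+1 = wpart w N + w N.
Proof. by rewrite /wpart big_ord_recr. Qed.

Section DecreasingWeight.
Variable w : nat -> R.
Hypothesis hw : decreasing_weight w.

Let w_ge0 := weight_ge0 hw.
Let w0 := weight0 hw.

Lemma weight_le m n : (m <= n)%N -> w n <= w m.
Proof.
move=> /subnKC <-; elim: (n - m)%N => [|d IH]; first by rewrite addn0.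
by rewrite addnS (le_trans (weightS_le hw _)).
Qed.

Lemma weight_le1 n : w n <= 1.
Proof. by rewrite -w0 weight_le. Qed.

Lemma wsum_ge0 y N F : 0 <= wsum w y N F.
Proof. by elim: F N => //= j F IH N; rewrite addr_ge0// mulr_ge0. Qed.

Lemma wsum_shift y M N F : (M <= N)%N -> wsum w y N F <= wsum w y M F.
Proof.
elim: F M N => //= j F IH M N MN; rewrite lerD// ?IH//.
by rewrite ler_wpM2r// weight_le.
Qed.

(** Dropping entries of a list moves the remaining ones to earlier ranks, where the weights are no
    smaller. *)
Lemma wsum_filter (p : pred nat) y N F :
  wsum w y N F <= wsum w y N (seq.filter p F) + wsum w y N (seq.filter (predC p) F).
Proof.
elim: F N => [|j F IH] N /=; first by rewrite addr0.
have sh G := wsum_shift y G (leqnSn N).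
case: (p j) => /=; have := IH N.+1.
- have := sh [seq x <- F | predC p x]; lra.
- have := sh [seq x <- F | p x]; lra.
Qed.

Lemma wsum_support (p : pred nat) y N F : (forall j, ~~ p j -> y j = 0) ->
  wsum w y N F <= wsum w y N (seq.filter p F).
Proof.
move=> y0; have := wsum_filter p y N F.
suff -> : wsum w y N [seq x <- F | predC p x] = 0 by rewrite addr0.
rewrite (@eq_wsum _ _ (fun=> 0 * 0)); first by rewrite wsumZ normr0 mul0r.
by move=> j; rewrite mem_filter /= mul0r => /andP[/y0].
Qed.

Lemma ler_wsum y z N F : {in F, forall j, `|y j| <= `|z j|} ->
  wsum w y N F <= wsum w z N F.
Proof.
elim: F N => //= j F IH N h; rewrite lerD//.
  by rewrite ler_wpM2l// h// mem_head.
by apply: IH => k kF; apply: h; rewrite inE kF orbT.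
Qed.

Lemma wsumD y z N F :
  wsum w (fun j => y j + z j) N F <= wsum w y N F + wsum w z N F.
Proof.
elim: F N => [|j F IH] N /=; first by rewrite addr0.
have := IH N.+1; have := ler_wpM2l (w_ge0 N) (ler_normD (y j) (z j)); lra.
Qed.

Lemma wsum_sum (I : eqType) (r : seq I) (y : I -> nat -> R) N F :
  wsum w (fun j => \sum_(i <- r) y i j) N F <= \sum_(i <- r) wsum w (y i) N F.
Proof.
elim: r => [|i r IH].
  rewrite big_nil (@eq_wsum _ _ (fun=> 0 * 0)); first by rewrite wsumZ normr0 mul0r.
  by move=> j _; rewrite big_nil mul0r.
rewrite big_cons (@eq_wsum _ _ (fun j => y i j + \sum_(i <- r) y i j)); last first.
  by move=> j _; rewrite big_cons.
by apply: (le_trans (wsumD _ _ _ _)); rewrite lerD2l.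
Qed.

Lemma wpart_ge0 N : 0 <= wpart w N.
Proof. by rewrite sumr_ge0. Qed.

Lemma wpart_le M N : (M <= N)%N -> wpart w M <= wpart w N.
Proof.
move=> /subnKC <-; elim: (N - M)%N => [|d IH]; first by rewrite addn0.
by rewrite addnS wpartS (le_trans IH)// lerDl.
Qed.

Lemma wpart_le_nat N : wpart w N <= N%:R.
Proof.
elim: N => [|N IH]; first by rewrite /wpart big_ord0.
by rewrite wpartS -natr1 lerD// weight_le1.
Qed.

Lemma wsum_le_wpart y N F (c : R) : 0 <= c -> {in F, forall j, `|y j| <= c} ->
  wsum w y N F <= wpart w (size F) * c.
Proof.
move=> c0 h; apply: (le_trans (wsum_shift y F (leq0n N))).
rewrite wsumE /wpart mulr_suml; apply: ler_sum => i _.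
by rewrite ler_wpM2l// h// mem_nth.
Qed.

Lemma wsum_ge_wpart y F (c : R) : {in F, forall j, c <= `|y j|} ->
  wpart w (size F) * c <= wsum w y 0 F.
Proof.
move=> h; rewrite wsumE /wpart mulr_suml; apply: ler_sum => i _.
by rewrite ler_wpM2l// h// mem_nth.
Qed.

Lemma wsum_le_size y N F (c : R) : 0 <= c -> {in F, forall j, `|y j| <= c} ->
  wsum w y N F <= (size F)%:R * c.
Proof.
move=> c0 h; apply: (le_trans (wsum_le_wpart N c0 h)).
by rewrite ler_wpM2r// wpart_le_nat.
Qed.

(* Only the first [N] terms of [F] see weights not already present at rank [N]. *)
Lemma wsum_split_bound y N F (c e : R) : uniq F -> 0 <= c ->
  {in F, forall j, `|y j| <= c} ->
  (forall G, uniq G -> wsum w y N G <= e) ->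
  wsum w y 0 F <= N%:R * c + e.
Proof.
move=> uF c0 h he; rewrite -(cat_take_drop N F) wsum_cat add0n.
have [sF|sF] := leqP (size F) N.
  rewrite drop_oversize//= addr0 take_oversize//.
  apply: (le_trans (wsum_le_size _ c0 h)).
  rewrite -[leLHS]addr0 lerD ?ler_wpM2r ?ler_nat//.
  exact: (le_trans (wsum_ge0 y N [::]) (he [::] isT)).
rewrite size_take sF lerD//.
  have := @wsum_le_size y 0 (take N F) c c0 _.
  by rewrite size_take sF; apply => j /mem_take /h.
by apply: he; rewrite drop_uniq.
Qed.

End DecreasingWeight.

(** Summation by parts. The induction keeps the boundary term, [al t] times the difference of the
    partial sums of [c] and [b]; it absorbs the decrease of [al] and is non-negative at the end. *)
Lemma abel_le (al b c : nat -> R) m :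
  (forall r, (r < m)%N -> 0 <= al r) ->
  (forall r, (r.+1 < m)%N -> al r.+1 <= al r) ->
  (forall t, (t <= m)%N -> \sum_(r < t) b r <= \sum_(r < t) c r) ->
  \sum_(r < m) al r * b r <= \sum_(r < m) al r * c r.
Proof.
move=> al0 alS bc; case: m => [|m] in al0 alS bc *; first by rewrite !big_ord0.
have key t : (t < m.+1)%N -> al t * (\sum_(r < t.+1) c r - \sum_(r < t.+1) b r)
    <= \sum_(r < t.+1) al r * c r - \sum_(r < t.+1) al r * b r.
  elim: t => [|t IH] tm; first by rewrite !big_ord_recl !big_ord0; lra.
  have sumS (f : nat -> R) k : \sum_(r < k.+1) f r = \sum_(r < k) f r + f k.
    by rewrite big_ord_recr.
  rewrite (sumS (fun r => al r * c r)) (sumS (fun r => al r * b r)).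
  rewrite (sumS c t.+1) (sumS b t.+1).
  have := IH (ltnW tm); have := alS t tm; have := bc t.+1 (ltnW tm).
  set C := \sum_(r < t.+1) c r; set B := \sum_(r < t.+1) b r.
  set X := \sum_(r < t.+1) _ * c _; set Y := \sum_(r < t.+1) _ * b _.
  move=> BC aa; have : 0 <= (al t - al t.+1) * (C - B) by rewrite mulr_ge0 ?subr_ge0.
  lra.
have := key m (ltnSn m); have := bc m.+1 (leqnn _); have := al0 m (ltnSn m).
set C := \sum_(r < m.+1) c r; set B := \sum_(r < m.+1) b r.
set X := \sum_(r < m.+1) _ * c _; set Y := \sum_(r < m.+1) _ * b _.
move=> a0 BC; have : 0 <= al m * (C - B) by rewrite mulr_ge0 ?subr_ge0.
lra.
Qed.

(* The [r]-th family has more elements than the [r] ones already picked. *)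
Lemma greedy_choice (P : nat -> nat -> Prop) M :
  (forall r, (r < M)%N -> exists F, [/\ uniq F, size F = r.+1 &
     forall j, j \in F -> P r j]) ->
  exists G, [/\ uniq G, size G = M & forall r, (r < M)%N -> P r (nth 0%N G r)].
Proof.
elim: M => [|M IH] h; first by exists [::].
have [|G [uG sG hG]] := IH; first by move=> r rM; apply: h; rewrite ltnS ltnW.
have [F [uF sF hF]] := h M (ltnSn M).
have [j jF jG] : exists2 j, j \in F & j \notin G.
  apply: contrapT => no; have : {subset F <= G}.
    by move=> j jF; apply/negP => /negP jG; apply: no; exists j.
  by move/(uniq_leq_size uF); rewrite sF sG ltnn.
exists (rcons G j); split; first by rewrite rcons_uniq jG.
  by rewrite size_rcons sG.
move=> r; rewrite ltnS leq_eqVlt => /orP[/eqP ->|rM]; last first.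
  by rewrite nth_rcons sG rM; apply: hG.
by rewrite nth_rcons sG ltnn eqxx; apply: hF.
Qed.

End WeightedSums.

(** * The Lorentz norm as a supremum over finite injections *)

Section LorentzNorm.
Variable R : realType.
Implicit Types (w y z : nat -> R) (F G : seq nat).

Definition lfinite w y := (lorentz_norm w y < +oo)%E.

Definition lnorm w y : R := fine (lorentz_norm w y).

Lemma astar_ge0 y k : (0 <= astar y k)%E.
Proof.
apply: ereal_sup_ubound; exists 0 => //; split => //.
exists (iota 0 k.+1); split; [exact: iota_uniq|exact: size_iota|].
by move=> j _; exact: normr_ge0.
Qed.

Lemma astar_ge y k (t : R) F : uniq F -> size F = k.+1 ->
  {in F, forall j, t <= `|y j|} -> (t%:E <= astar y k)%E.
Proof.
move=> uF sF h; have [t0|/ltW t0] := leP 0 t.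
  by apply: ereal_sup_ubound; exists t => //; split => //; exists F.
by apply: le_trans (astar_ge0 y k); rewrite lee_fin.
Qed.

Lemma astar_le y k (B : R) : (forall j, `|y j| <= B) -> (astar y k <= B%:E)%E.
Proof.
move=> yB; apply: ge_ereal_sup => _ /= [t [t0 [[|j F] [_ // _ h]]] <-].
by rewrite lee_fin (le_trans (h j _))// mem_head.
Qed.

Lemma astar_gt y k (t : R) : (t%:E < astar y k)%E ->
  exists F, [/\ uniq F, size F = k.+1 & forall j, j \in F -> t <= `|y j|].
Proof.
move=> /ereal_sup_gt[_ /= [u [u0 [F [uF sF h]]] <-]]; rewrite lte_fin => tu.
by exists F; split=> // j /h; apply: le_trans; exact: ltW.
Qed.

Lemma seq_argmin (f : nat -> R) F : F != [::] ->
  exists2 j, j \in F & {in F, forall k, f j <= f k}.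
Proof.
elim: F => // i F IH _; have [->|/IH[j jF hj]] := eqVneq F [::].
  by exists i; rewrite ?mem_head// => k; rewrite inE => /eqP ->.
have [ij|/ltW ji] := leP (f i) (f j).
  exists i; rewrite ?mem_head// => k; rewrite inE => /orP[/eqP ->//|/hj].
  exact: le_trans.
by exists j; rewrite ?inE ?jF ?orbT// => k; rewrite inE => /orP[/eqP ->//|/hj].
Qed.

(** Remove the entry of least modulus: all [size F] entries are at least that large, so it is
    bounded by the last term of the rearrangement, and induction handles the rest. *)
Lemma sum_le_astar y (B : R) F : (forall j, `|y j| <= B) -> uniq F ->
  \sum_(j <- F) `|y j| <= \sum_(r < size F) fine (astar y r).
Proof.
move=> yB; have fa k : (fine (astar y k))%:E = astar y k.
  by rewrite fineK// ge0_fin_numE ?astar_ge0// (le_lt_trans (astar_le k yB)) ?ltry.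
move sF : (size F) => s; elim: s F sF => [|s IH] F sF uF.
  by rewrite (size0nil sF) big_nil big_ord0.
have [|j jF hj] := @seq_argmin (fun j => `|y j|) F; first by rewrite -size_eq0 sF.
rewrite (big_rem j)//= big_ord_recr /= addrC lerD//.
  by apply: IH; rewrite ?rem_uniq// size_rem// sF.
by rewrite -lee_fin fa; exact: (astar_ge uF sF).
Qed.

Section FixedWeight.
Variable w : nat -> R.
Hypothesis hw : decreasing_weight w.

Let w_ge0 := weight_ge0 hw.
Let w0 := weight0 hw.

Let term_ge0 y k : (0 <= (w k)%:E * astar y k)%E.
Proof. by rewrite mule_ge0 ?lee_fin ?astar_ge0. Qed.

Lemma lorentz_norm_ge0 y : (0 <= lorentz_norm w y)%E.
Proof. by apply: nneseries_ge0 => k _ _; exact: term_ge0. Qed.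

(** Replaces rearrangements by finite injections. One direction is Abel summation applied to
    [sum_le_astar]; the other picks, rank by rank, distinct indices that nearly attain [astar]. *)
Lemma lorentz_normP y (C : R) :
  (lorentz_norm w y <= C%:E)%E <-> forall F, uniq F -> wsum w y 0 F <= C.
Proof.
split=> [yC F uF|h].
  have yB j : `|y j| <= C.
    rewrite -lee_fin; apply: le_trans yC.
    apply: (@le_trans _ _ (astar y 0)).
      by apply: (@astar_ge _ _ _ [:: j]) => // k; rewrite inE => /eqP ->.
    have := @nneseries_lim_ge R (fun k => (w k)%:E * astar y k)%E xpredT 0 1
      (fun k _ _ => term_ge0 y k).
    by rewrite big_nat1 w0 mul1e.
  have fa k : (fine (astar y k))%:E = astar y k.
    by rewrite fineK// ge0_fin_numE ?astar_ge0// (le_lt_trans (astar_le k yB)) ?ltry.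
  have le1 : wsum w y 0 F <= \sum_(r < size F) w r * fine (astar y r).
    rewrite wsumE; under eq_bigr do rewrite add0n.
    apply: (@abel_le _ w (fun r => `|y (nth 0%N F r)|) (fun r => fine (astar y r))) => //.
    - by move=> r _; exact: weightS_le.
    - move=> t tF; have := @sum_le_astar y C (take t F) yB (take_uniq t uF).
      rewrite (big_nth 0%N) big_mkord size_takel//.
      by under eq_bigr => i _ do rewrite nth_take//.
  rewrite -lee_fin; apply: le_trans yC.
  apply: (@le_trans _ _ (\sum_(0 <= r < size F) (w r)%:E * astar y r)%E).
    rewrite big_mkord -lee_fin in le1 *; rewrite -sumEFin in le1.
    by apply: le_trans le1 _; apply: lee_sum => r _; rewrite EFinM fa.
  by apply: nneseries_lim_ge => k _ _; exact: term_ge0.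
have yB j : `|y j| <= C by have := h [:: j] isT; rewrite /= w0 mul1r addr0.
have fa k : (fine (astar y k))%:E = astar y k.
  by rewrite fineK// ge0_fin_numE ?astar_ge0// (le_lt_trans (astar_le k yB)) ?ltry.
apply: lime_le; first by apply: is_cvg_nneseries => k _ _; exact: term_ge0.
apply: nearW => M; rewrite big_mkord.
under eq_bigr do rewrite -fa -EFinM.
rewrite sumEFin lee_fin; apply/ler_addgt0Pr => e e0.
(* The weights are at most 1, so an error [d] at each of [M] ranks costs at most [e]. The successor
   covers [M = 0]. *)
pose d := e / M.+1%:R; have d0 : 0 < d by rewrite divr_gt0.
have [G [uG sG hG]] : exists G, [/\ uniq G, size G = M &
    forall r, (r < M)%N -> fine (astar y r) - d <= `|y (nth 0%N G r)|].
  apply: (@greedy_choice (fun r j => fine (astar y r) - d <= `|y j|)) => r rM.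
  by apply: astar_gt; rewrite -fa lte_fin; lra.
have := h _ uG; rewrite wsumE sG; under eq_bigr do rewrite add0n.
move=> hC; apply: (@le_trans _ _ (\sum_(i < M) w i * `|y (nth 0%N G i)| + M%:R * d)).
  have -> : M%:R * d = \sum_(i < M) d by rewrite sumr_const card_ord mulr_natl.
  rewrite -big_split /=; apply: ler_sum => i _.
  have := hG i (ltn_ord i); have := weight_le1 hw i; have := w_ge0 i.
  set W := w i; set a := fine _; set b := `| _ |; nra.
rewrite lerD// /d mulrC mulrAC ler_pdivrMr// ler_pM2l// ler_nat //.
Qed.

Lemma lnorm_ge0 y : 0 <= lnorm w y.
Proof. by rewrite fine_ge0// lorentz_norm_ge0. Qed.

Lemma lfiniteP y (C : R) : (forall F, uniq F -> wsum w y 0 F <= C) -> lfinite w y.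
Proof. by move/lorentz_normP => h; rewrite /lfinite (le_lt_trans h)// ltry. Qed.

Lemma lnorm_le y (C : R) : (forall F, uniq F -> wsum w y 0 F <= C) -> lnorm w y <= C.
Proof.
move=> h; have := lfiniteP h; rewrite /lfinite -ge0_fin_numE ?lorentz_norm_ge0// => f.
by rewrite -lee_fin fineK//; exact/lorentz_normP.
Qed.

Lemma wsum_le_lnorm y F : lfinite w y -> uniq F -> wsum w y 0 F <= lnorm w y.
Proof.
rewrite /lfinite -ge0_fin_numE ?lorentz_norm_ge0// => f; move: F.
by apply/lorentz_normP; rewrite fineK.
Qed.

Lemma coord_le_lnorm y j : lfinite w y -> `|y j| <= lnorm w y.
Proof.
by move=> f; have := @wsum_le_lnorm y [:: j] f isT; rewrite /= w0 mul1r addr0.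
Qed.

Lemma lnorm_gt y (t : R) : lfinite w y -> t < lnorm w y ->
  exists2 F, uniq F & t < wsum w y 0 F.
Proof.
move=> f; rewrite ltNge => /negP h; apply: contrapT => no; apply: h.
apply: lnorm_le => F uF; rewrite leNgt; apply/negP => tF; apply: no; by exists F.
Qed.

Lemma lfiniteD y z : lfinite w y -> lfinite w z -> lfinite w (fun j => y j + z j).
Proof.
move=> fy fz; apply: (@lfiniteP _ (lnorm w y + lnorm w z)) => F uF.
by rewrite (le_trans (wsumD hw _ _ _ _))// lerD// wsum_le_lnorm.
Qed.

Lemma lnormD y z : lfinite w y -> lfinite w z ->
  lnorm w (fun j => y j + z j) <= lnorm w y + lnorm w z.
Proof.
move=> fy fz; apply: lnorm_le => F uF.
by rewrite (le_trans (wsumD hw _ _ _ _))// lerD// wsum_le_lnorm.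
Qed.

Lemma lfiniteZ (c : R) y : lfinite w y -> lfinite w (fun j => c * y j).
Proof.
move=> fy; apply: (@lfiniteP _ (`|c| * lnorm w y)) => F uF.
by rewrite wsumZ ler_wpM2l// wsum_le_lnorm.
Qed.

Lemma lnormZ (c : R) y : lfinite w y -> lnorm w (fun j => c * y j) = `|c| * lnorm w y.
Proof.
have le d z : lfinite w z -> lnorm w (fun j => d * z j) <= `|d| * lnorm w z.
  move=> fz; apply: lnorm_le => F uF.
  by rewrite wsumZ ler_wpM2l// wsum_le_lnorm.
move=> fy; apply/eqP; rewrite eq_le le//=.
have [->|c0] := eqVneq c 0; first by rewrite normr0 mul0r lnorm_ge0.
have := le c^-1 _ (lfiniteZ c fy); rewrite normfV ler_pdivlMl ?normr_gt0//.
suff -> : (fun j => c^-1 * (c * y j)) = y by [].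
by apply/funext => j; rewrite mulKf.
Qed.

Lemma finsupp_bound y m : (forall j, (m <= j)%N -> y j = 0) ->
  forall F, uniq F -> wsum w y 0 F <= \sum_(j < m) `|y j|.
Proof.
move=> y0 F uF.
apply: (le_trans (@wsum_support _ _ hw (fun j => j < m)%N y 0 F _)).
  by move=> j; rewrite -leqNgt => /y0.
have uG := filter_uniq (fun j => j < m)%N uF.
have sG : {subset [seq j <- F | (j < m)%N] <= iota 0 m}.
  by move=> j; rewrite mem_filter mem_iota => /andP[].
set G := [seq _ <- _ | _] in uG sG *.
apply: (@le_trans _ _ (\sum_(j <- G) `|y j|)).
  rewrite wsumE (big_nth 0%N) big_mkord; apply: ler_sum => i _.
  by rewrite ler_piMl// weight_le1.
rewrite -(big_mkord xpredT (fun j => `|y j|)) /index_iota subn0.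
have p : perm_eq (iota 0 m) (G ++ [seq j <- iota 0 m | j \notin G]).
  rewrite -(perm_filterC (mem G)) perm_cat//; apply: uniq_perm => //.
    by rewrite filter_uniq// iota_uniq.
  by move=> j; rewrite mem_filter; apply/andP/idP => [[]//|jG]; split=> //; exact: sG.
by rewrite (perm_big _ p) /= big_cat lerDl sumr_ge0.
Qed.

Lemma lfinite_finsupp y m : (forall j, (m <= j)%N -> y j = 0) -> lfinite w y.
Proof. by move=> y0; exact: lfiniteP (finsupp_bound y0). Qed.

Lemma ler_lnorm y z : lfinite w z -> (forall j, `|y j| <= `|z j|) ->
  lfinite w y /\ lnorm w y <= lnorm w z.
Proof.
move=> fz yz; have b F : uniq F -> wsum w y 0 F <= lnorm w z.
  by move=> uF; apply: le_trans (wsum_le_lnorm fz uF); apply: ler_wsum.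
by split; [exact: lfiniteP b|exact: lnorm_le].
Qed.

End FixedWeight.
End LorentzNorm.

(** * Submultiplicative weights, described through their partial sums *)

Record submult_weight (R : realType) (w : nat -> R) : Prop := SubmultWeight {
  submult_weight_decreasing : decreasing_weight w;
  submult_weight_cvg0 : forall e : R, 0 < e -> exists N, w N <= e;
  submult_weight_unbounded : forall C : R, exists N, C < wpart w N;
  submult_weight_wpartM : forall M N, wpart w (M * N) <= wpart w M * wpart w N }.

Lemma wpart_weight (R : realType) (S : R -> R) N : S 1 = 1 ->
  wpart (weight S) N.+1 = S N.+1%:R.
Proof.
move=> S1; elim: N => [|N IH]; first by rewrite /wpart big_ord1 S1.
by rewrite wpartS IH /= addrC subrK.
Qed.

(** The partial sums of the weight telescope to [S]. Its monotonicity is midpoint concavity of [S]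
    at three consecutive integers, except for the first step, where [S 1 = 1] and [S 2 = 2] make
    both weights equal to 1. *)
Lemma submult_weight_of (R : realType) (S : R -> R) : submultiplicative S ->
  (weight S @ \oo --> (0 : R))%classic ->
  (forall M : R, exists m : nat, (1 <= m)%N /\ M < S m%:R) ->
  submult_weight (weight S).
Proof.
move=> [_ _ Smon Sconc [S12 SM]] cv unb.
have S1 : S 1 = 1 by apply: S12; rewrite lexx/=; lra.
have S2 : S 2 = 2 by apply: S12; rewrite lexx andbT; lra.
split.
- split=> // [[|k]|[|k]] //=.
  + by rewrite subr_ge0 ltW// Smon// ?ler1n// ltr_nat.
  + by rewrite S1 S2; lra.
  + have := Sconc k.+1%:R k.+3%:R 2^-1; rewrite !ler1n => /(_ isT isT).
    have -> : 2^-1 * k.+1%:R + (1 - 2^-1) * k.+3%:R = k.+2%:R :> R.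
      by rewrite -!natr1; field.
    move=> /(_ _)/wrap[]; first by apply/andP; split; lra.
    lra.
- move=> e e0; move/cvgrPdist_le : cv => /(_ e e0)[N _ /(_ N (leqnn N))].
  by rewrite sub0r normrN => h; exists N; rewrite (le_trans (ler_norm _)).
- by move=> C; have [[|m] [// _ Cm]] := unb C; exists m.+1; rewrite wpart_weight.
- move=> [|M] [|N]; rewrite ?mul0n ?muln0; try by rewrite /wpart big_ord0 ?mulr0 ?mul0r.
  rewrite mulSn addSn !wpart_weight// -addSn -mulSn natrM.
  by apply: SM; rewrite ler1n.
Qed.

(** * Tails, dilations and level sets for a single weight *)

Section SubmultWeight.
Variables (R : realType) (w : nat -> R).
Hypothesis sw : submult_weight w.
Implicit Types (y z a : nat -> R) (F G : seq nat).

Let hw := submult_weight_decreasing sw.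

Lemma wsum_le_head y N F (c : R) : {in F, forall j, `|y j| <= c} ->
  wsum w y N F <= (size F)%:R * (w N * c).
Proof.
elim: F N => [|j F IH] N h /=; first by rewrite mul0r.
have c0 : 0 <= c by rewrite (le_trans (normr_ge0 (y j)))// h// mem_head.
rewrite -natr1 mulrDl mul1r addrC lerD//.
  apply: (@le_trans _ _ ((size F)%:R * (w N.+1 * c))).
    by apply: IH => k kF; apply: h; rewrite inE kF orbT.
  by rewrite ler_wpM2l// ler_wpM2r// (weightS_le hw).
by rewrite ler_wpM2l ?(weight_ge0 hw)// h// mem_head.
Qed.

(** Let [F0] nearly attain the norm. Indices outside [F0], ranked after it, extend [F0] and so add
    at most [e / 2]. The indices in [F0] are bounded in number, and their weights from rank [N] on
    are at most [w N], which is small. *)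
Lemma wsum_tail_small y (e : R) : lfinite w y -> 0 < e ->
  exists N, forall F, uniq F -> wsum w y N F <= e.
Proof.
move=> fy e0; have [|F0 uF0 hF0] := lnorm_gt hw fy (t := lnorm w y - e / 2); first by lra.
set M := size F0; pose B := M.+1%:R * (lnorm w y + 1).
have ny := lnorm_ge0 hw y.
have B0 : 0 < B by rewrite mulr_gt0// addrC ltr_pwDl.
have [|N0 hN0] := submult_weight_cvg0 sw (e := e / 2 / B).
  by rewrite !divr_gt0.
exists (maxn M N0) => F uF; set N := maxn M N0.
have wN : w N <= e / 2 / B by apply: le_trans hN0; apply: weight_le; rewrite ?leq_maxr.
apply: (le_trans (wsum_filter hw (mem F0) y N F)).
set F1 := seq.filter (mem F0) F; set F2 := seq.filter _ F.
have h2 : wsum w y N F2 <= e / 2.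
  apply: (@le_trans _ _ (wsum w y M F2)); first by rewrite wsum_shift ?leq_maxl.
  have := @wsum_le_lnorm _ _ hw y (F0 ++ F2) fy; rewrite wsum_cat add0n => /(_ _)/wrap[].
    rewrite cat_uniq uF0 filter_uniq ?andbT//=; apply/hasPn => j.
    by rewrite mem_filter => /andP[].
  rewrite -/M; lra.
have h1 : wsum w y N F1 <= e / 2.
  apply: (le_trans (@wsum_le_head y N F1 (lnorm w y) _)).
    by move=> j _; exact: coord_le_lnorm.
  have sF1 : (size F1 <= M)%N.
    apply: uniq_leq_size; first by rewrite filter_uniq.
    by move=> j; rewrite mem_filter => /andP[].
  apply: (@le_trans _ _ (M.+1%:R * (w N * (lnorm w y + 1)))).
    apply: ler_pM => //; first by rewrite mulr_ge0// (weight_ge0 hw).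
      by rewrite ler_nat ltnW.
    by rewrite ler_wpM2l ?(weight_ge0 hw)// lerDl.
  by rewrite mulrCA -/B -ler_pdivlMr.
lra.
Qed.

Definition ind G : nat -> R := fun j => (j \in G)%:R.

Lemma wsum_ind_le F G : uniq F -> wsum w (ind G) 0 F <= wpart w (size G).
Proof.
move=> uF; apply: (le_trans (@wsum_support _ _ hw (mem G) _ _ _ _)).
  by move=> j /negbTE jG; rewrite /ind [j \in G]jG.
set F1 := seq.filter _ F.
apply: (@le_trans _ _ (wpart w (size F1) * 1)).
  by apply: wsum_le_wpart => // j _; rewrite /ind ger0_norm ?lern1 ?leq_b1.
rewrite mulr1 wpart_le// uniq_leq_size// ?filter_uniq//.
by move=> j; rewrite mem_filter => /andP[].
Qed.

Lemma wsum_ind_cat F G1 G2 N : {in G1, forall j, j \notin G2} ->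
  wsum w (ind (G1 ++ G2)) N F = wsum w (ind G1) N F + wsum w (ind G2) N F.
Proof.
move=> d; elim: F N => [|j F IH] N /=; first by rewrite addr0.
rewrite IH /ind mem_cat; have := d j.
case: (j \in G1) => [/(_ isT)/negbTE ->|_] /=; rewrite !ger0_norm//; lra.
Qed.

(** Disjointness turns the sum of the indicators into the indicator of the concatenated list, which
    has at most [size s * c] elements. *)
Lemma sum_wsum_ind (L : nat -> seq nat) (c : nat) (s : seq nat) F :
  uniq F -> uniq s -> {in s, forall l, size (L l) <= c}%N ->
  {in s &, forall l l', l != l' -> {in L l, forall j, j \notin L l'}} ->
  \sum_(l <- s) wsum w (ind (L l)) 0 F <= wpart w (size s * c).
Proof.
move=> uF us sc d.
have -> : \sum_(l <- s) wsum w (ind (L l)) 0 F = wsum w (ind (flatten (map L s))) 0 F.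
  elim: s us d {sc} => [|l s IH] /= => [_ _|/andP[ls us] d].
    by rewrite big_nil (@eq_wsum _ _ _ (fun=> 0 * 0)) ?wsumZ ?normr0 ?mul0r.
  rewrite big_cons IH//; last first.
    by move=> x y xs ys; apply: d; rewrite inE ?xs ?ys orbT.
  rewrite -wsum_ind_cat// => j jl; apply/flattenP => -[_ /mapP[l' l's ->]].
  apply/negP; apply: d jl; rewrite ?mem_head ?inE ?l's ?orbT//.
  by apply: contraNneq ls => ->.
apply: (le_trans (wsum_ind_le _ uF)); apply: wpart_le => //.
elim: s sc {us d} => //= l s IH sc; rewrite size_cat mulSn leq_add//.
  by apply: sc; rewrite mem_head.
by apply: IH => k ks; apply: sc; rewrite inE ks orbT.
Qed.

(* Abel summation reduces to indicators, where this is submultiplicativity. *)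
Lemma wsum_dilation (L : nat -> seq nat) (c m : nat) a F :
  uniq F -> (forall j, (m <= j)%N -> a j = 0) ->
  (forall l, (l < m)%N -> size (L l) <= c)%N ->
  (forall l l', (l < m)%N -> (l' < m)%N -> l != l' ->
     {in L l, forall j, j \notin L l'}) ->
  wsum w (fun j => \sum_(l <- iota 0 m) `|a l| * ind (L l) j) 0 F <=
  wpart w c * lnorm w a.
Proof.
move=> uF am sL dL; apply: (le_trans (wsum_sum hw _ _ _ _)).
under eq_bigr do rewrite wsumZ normr_id.
(* Listing the blocks by decreasing [|a l|] makes these moduli admissible coefficients for
   [abel_le]. *)
pose leR l l' := `|a l'| <= `|a l|.
pose s := sort leR (iota 0 m).
have ps : perm_eq s (iota 0 m) by rewrite perm_sort.
have us : uniq s by rewrite (perm_uniq ps) iota_uniq.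
have ms l : (l \in s) = (l < m)%N by rewrite (perm_mem ps) mem_iota.
have ss : size s = m by rewrite (perm_size ps) size_iota.
have srt : sorted leR s by apply: sort_sorted => x y; rewrite /leR le_total.
rewrite -(perm_big _ ps) /= (big_nth 0%N) big_mkord ss.
apply: (@le_trans _ _ (\sum_(r < m) `|a (nth 0%N s r)| * (wpart w c * w r))).
  apply: (@abel_le _ (fun r => `|a (nth 0%N s r)|)
     (fun r => wsum w (ind (L (nth 0%N s r))) 0 F) (fun r => wpart w c * w r)) => //.
    move=> r rm; have := sorted_ltn_nth (leT := leR) _ 0%N srt.
    move=> /(_ _)/wrap[]; first by move=> x y z h1 h2; exact: le_trans h2 h1.
    by move=> /(_ r r.+1); rewrite !inE ss; apply=> //; exact: ltnW.
  (* The first [t] blocks fill at most [t * c] indices, and submultiplicativity separates the two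
     factors. *)
  move=> t tm; rewrite -mulr_sumr.
  have := @sum_wsum_ind L c (take t s) F uF (take_uniq t us).
  move=> /(_ _)/wrap[]; first by move=> l /mem_take; rewrite ms => /sL.
  move=> /(_ _)/wrap[]; first by move=> l l' /mem_take + /mem_take; rewrite !ms; exact: dL.
  rewrite (big_nth 0%N) big_mkord size_takel ?ss//.
  under eq_bigr => i _ do rewrite nth_take//.
  move=> /le_trans; apply; rewrite -/(wpart w t) mulrC.
  exact: submult_weight_wpartM.
have -> : \sum_(r < m) `|a (nth 0%N s r)| * (wpart w c * w r) = wpart w c * wsum w a 0 s.
  by rewrite wsumE ss mulr_sumr; apply: eq_bigr => i _; rewrite add0n mulrCA [w i * _]mulrC.
rewrite ler_wpM2l ?wpart_ge0//; apply: wsum_le_lnorm => //.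
exact: lfinite_finsupp am.
Qed.

(** A list of [N] indices with [t <= |y j|] would force a norm of at least [wpart w N * t], which is
    too large. Hence greedy extension stops; [d] bounds the number of extensions still possible. *)
Lemma exists_level_set y (t : R) : lfinite w y -> 0 < t ->
  exists G, uniq G /\ forall j, (j \in G) = (t <= `|y j|).
Proof.
move=> fy t0; have [N hN] := submult_weight_unbounded sw (lnorm w y / t).
suff key d G : (N <= size G + d)%N -> uniq G -> {in G, forall j, t <= `|y j|} ->
    exists G, uniq G /\ forall j, (j \in G) = (t <= `|y j|).
  by apply: (key N [::]).
elim: d G => [|d IH] G sG uG hG.
  have := le_trans (wsum_ge_wpart hw hG) (wsum_le_lnorm hw fy uG).
  rewrite -ler_pdivlMr// leNgt => /negP[]; apply: (lt_le_trans hN).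
  by apply: wpart_le => //; rewrite addn0 in sG.
have [[j [jG tj]]|no] := pselect (exists j, j \notin G /\ t <= `|y j|).
  apply: (IH (j :: G)) => /=; rewrite ?jG ?addSnnS//.
  by move=> k; rewrite inE => /orP[/eqP ->|/hG].
exists G; split=> // j; apply/idP/idP => [/hG//|tj].
by apply/negP => /negP jG; apply: no; exists j.
Qed.

(** A chosen enumeration of the level set; the default [[::]] occurs only when that set is
    infinite. *)
Definition level_set y (t : R) : seq nat :=
  xget [::] [set G : seq nat | uniq G /\ forall j, (j \in G) = (t <= `|y j|)]%classic.

Lemma level_setP y (t : R) : lfinite w y -> 0 < t ->
  uniq (level_set y t) /\ forall j, (j \in level_set y t) = (t <= `|y j|).
Proof.
move=> fy t0; have [G hG] := exists_level_set fy t0.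
exact: (xgetPex [::] (P := [set G | uniq G /\ forall j, (j \in G) = (t <= `|y j|)]%classic)
  (ex_intro _ G hG)).
Qed.

Lemma size_level_set y (t : R) N : lfinite w y -> 0 < t ->
  lnorm w y < wpart w N * t -> (size (level_set y t) < N)%N.
Proof.
move=> fy t0 hN; have [uG hG] := level_setP fy t0.
rewrite ltnNge; apply/negP => NG.
have : {in level_set y t, forall j, t <= `|y j|} by move=> j; rewrite hG.
move=> /(wsum_ge_wpart hw)/le_trans/(_ (wsum_le_lnorm hw fy uG)).
apply/negP; rewrite -ltNge (lt_le_trans hN)// ler_wpM2r ?(ltW t0)//.
exact: wpart_le.
Qed.

(** The sum counts the positive multiples of [t] up to [v], so it is the integer part of [v / t]. *)
Lemma level_floor (v t : R) D : 0 <= v -> v < D.+1%:R * t ->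
  v < (\sum_(q < D) (q.+1%:R * t <= v)%R%:R + 1) * t.
Proof.
move=> v0; elim: D => [|D IH] vD; first by rewrite big_ord0 add0r.
have [le|lt] := leP (D.+1%:R * t) v.
  have t0 : 0 < t by nra.
  rewrite (eq_bigr (fun=> 1)) ?sumr_const ?card_ord ?natr1// => q _.
  by rewrite (le_trans _ le)// ler_pM2r// ler_nat.
by rewrite big_ord_recr /= leNgt lt addr0; exact: IH.
Qed.

(** A layer-cake estimate. If [K r] of the level sets have more than [r] elements, then [r.+1]
    indices carry values of modulus at least [K r * t]. Distinct indices are chosen greedily, and
    exchanging the sums over ranks and levels gives the left side. *)
Lemma level_lower y (t : R) D : lfinite w y -> 0 < t ->
  t * \sum_(q < D) wpart w (size (level_set y (q.+1%:R * t))) <= lnorm w y.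
Proof.
move=> fy t0; pose c q := size (level_set y (q.+1%:R * t)).
have qt q : 0 < q.+1%:R * t by rewrite mulr_gt0.
have c_dec p q : (p <= q)%N -> (c q <= c p)%N.
  move=> pq; have [uq hq] := level_setP fy (qt q); have [up hp] := level_setP fy (qt p).
  apply: uniq_leq_size => // j; rewrite hq hp; apply: le_trans.
  by rewrite ler_pM2r// ler_nat.
pose K r := (\sum_(q < D) (r < c q))%N.
have [G [uG sG hG]] : exists G, [/\ uniq G, size G = c 0%N &
    forall r, (r < c 0)%N -> (K r)%:R * t <= `|y (nth 0%N G r)|].
  apply: (@greedy_choice (fun r j => (K r)%:R * t <= `|y j|)) => r _.
  case E : (K r) => [|k].
    exists (iota 0 r.+1); split; rewrite ?iota_uniq ?size_iota//.
    by move=> j _; rewrite mul0r.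
  (* Level sets shrink as the height grows, so those with more than [r] elements are the lowest
     [k.+1] ones, among them the one of index [k]. *)
  have rk : (r < c k)%N.
    rewrite ltnNge; apply/negP => ck; suff : (K r <= k)%N by rewrite E ltnn.
    rewrite /K; apply: (@leq_trans (\sum_(q < D) (q < k))).
      apply: leq_sum => q _; have [_|kq] := ltnP q k; first by rewrite leq_b1.
      by rewrite ltnNge (leq_trans (c_dec _ _ kq) ck).
    clear; elim: D => [|D IH]; first by rewrite big_ord0.
    rewrite big_ord_recr /=; have [Dk|] := ltnP D k; last by rewrite addn0.
    apply: (leq_trans _ Dk); rewrite -addn1 leq_add//.
    rewrite -[leqRHS]card_ord -sum1_card; apply: leq_sum => i _.
    by rewrite leq_b1.
  have [uk hk] := level_setP fy (qt k).
  exists (take r.+1 (level_set y (k.+1%:R * t))); split; first exact: take_uniq.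
    by rewrite size_takel.
  by move=> j /mem_take; rewrite hk.
apply: le_trans (wsum_le_lnorm hw fy uG); rewrite wsumE sG.
apply: (@le_trans _ _ (\sum_(r < c 0%N) w r * ((K r)%:R * t))); last first.
  by apply: ler_sum => r _; rewrite add0n ler_wpM2l ?(weight_ge0 hw)// hG.
rewrite le_eqVlt; apply/orP; left; apply/eqP.
transitivity (t * \sum_(q < D) \sum_(r < c 0%N) w r * (r < c q)%N%:R).
  congr (_ * _); apply: eq_bigr => q _; rewrite -/(c q) /wpart.
  rewrite (big_ord_widen _ w (c_dec 0%N q (leq0n q))) big_mkcond /=.
  by apply: eq_bigr => r _; case: ifP => _; rewrite ?mulr1 ?mulr0.
rewrite exchange_big /= mulr_sumr; apply: eq_bigr => r _.
by rewrite /K natr_sum -mulr_sumr mulrC -mulrA.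
Qed.

End SubmultWeight.

Lemma sum_iota (R : realType) (f : nat -> R) m :
  \sum_(l <- iota 0 m) f l = \sum_(l < m) f l.
Proof. by rewrite -{1}(subn0 m) -/(index_iota 0 m) big_mkord. Qed.

(** * Linear combinations of functions with disjoint level sets *)

Section DisjointBlocks.
Variables (R : realType) (w : nat -> R).
Hypothesis sw : submult_weight w.
Implicit Types (y z a : nat -> R) (F G : seq nat).

Let hw := submult_weight_decreasing sw.

Variables (m : nat) (ys : nat -> nat -> R) (a : nat -> R) (t : R).
Hypotheses (m0 : (0 < m)%N) (am : forall j, (m <= j)%N -> a j = 0).
Hypothesis ysf : forall l, (l < m)%N -> lfinite w (ys l).
Hypothesis t0 : 0 < t.
Hypothesis ysd : forall l l', (l < m)%N -> (l' < m)%N -> l != l' ->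
  {in level_set (ys l) t, forall j, j \notin level_set (ys l') t}.

Let fa : lfinite w a := lfinite_finsupp hw am.
Let na := lnorm_ge0 hw a.

Lemma sum_abs_le_lnorm : \sum_(l < m) `|a l| <= m%:R * lnorm w a.
Proof.
rewrite mulr_natl -[m in leRHS]card_ord -sumr_const; apply: ler_sum => l _.
exact: coord_le_lnorm.
Qed.

(* Each [ys l] is cut at height [t]; the high part is dominated by twice the
   sum of its level sets, whose sizes do not depend on [l]. *)
Lemma block_upper (e : R) N D (c : nat -> nat) :
  (forall l, (l < m)%N -> lnorm w (ys l) <= 1) ->
  1 < D.+1%:R * t ->
  (forall l, (l < m)%N -> forall F, uniq F -> wsum w (ys l) N F <= e) ->
  m%:R * (N%:R * t + e) <= 1 ->
  (forall l q, (l < m)%N -> (q < D)%N -> size (level_set (ys l) (q.+1%:R * t)) = c q) ->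
  lnorm w (fun j => \sum_(l < m) a l * ys l j) <= 3 * lnorm w a.
Proof.
move=> ys1 Dt tail mNe szc; apply: lnorm_le => // F uF.
pose u l j := if t <= `|ys l j| then `|ys l j| else 0.
pose v l j := if t <= `|ys l j| then 0 else `|ys l j|.
pose L q l := level_set (ys l) (q.+1%:R * t).
have qt q : 0 < q.+1%:R * t by rewrite mulr_gt0.
have vb l : (l < m)%N -> wsum w (v l) 0 F <= N%:R * t + e.
  move=> lm; apply: wsum_split_bound => //; first exact: ltW.
    by move=> j _; rewrite /v; case: (leP t) => [_|/ltW]; rewrite ?normr0 ?normr_id// ltW.
  move=> G uG; apply: le_trans (tail l lm G uG); apply: ler_wsum => // j _.
  by rewrite /v; case: ifP; rewrite ?normr0 ?normr_id.
have ub l j : (l < m)%N -> u l j <= \sum_(q <- iota 0 D) 2 * t * ind R (L q l) j.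
  move=> lm; rewrite /u; case: (leP t) => [tj|_]; last first.
    by rewrite sumr_ge0// => q _; rewrite mulr_ge0// mulr_ge0// ltW.
  have y1 : `|ys l j| <= 1 by rewrite (le_trans (coord_le_lnorm hw _ (ysf lm)))// ys1.
  have -> : \sum_(q <- iota 0 D) 2 * t * ind R (L q l) j =
      2 * t * \sum_(q < D) (q.+1%:R * t <= `|ys l j|)%R%:R.
    rewrite sum_iota mulr_sumr; apply: eq_bigr => q _.
    by rewrite /ind (level_setP sw (ysf lm) (qt q)).2.
  (* With [s] levels reached, [|ys l j| < (s + 1) * t]; since [t <= |ys l j|] gives [1 <= s], this
     is at most [2 * t * s]. *)
  have := level_floor (normr_ge0 (ys l j)) (le_lt_trans y1 Dt).
  suff : 1 <= \sum_(q < D) (q.+1%:R * t <= `|ys l j|)%R%:R :> R.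
    set s := \sum_(q < D) _; set Y := `| _ | => s1 hY.
    have : 0 <= t * (s - 1) by rewrite mulr_ge0 ?subr_ge0// ltW.
    lra.
  case: D Dt {szc} => [|D] Dt; first by lra.
  by rewrite big_ord_recl /= mul1r tj lerDl sumr_ge0.
(* One copy of the norm pays for the low parts, two copies for the high parts. *)
have -> : 3 * lnorm w a = lnorm w a + 2 * lnorm w a by ring.
apply: (@le_trans _ _ (wsum w (fun j => \sum_(l <- iota 0 m) `|a l| * v l j) 0 F +
   wsum w (fun j => \sum_(q <- iota 0 D)
     2 * t * (\sum_(l <- iota 0 m) `|a l| * ind R (L q l) j)) 0 F)).
  apply: le_trans (wsumD hw _ _ _ _); apply: ler_wsum => // j _.
  apply: le_trans (ler_norm _).
  apply: (@le_trans _ _ (\sum_(l <- iota 0 m) `|a l| * v l j +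
      \sum_(l <- iota 0 m) `|a l| * u l j)).
    rewrite -big_split /= sum_iota.
    apply: (le_trans (ler_norm_sum _ _ _)); apply: ler_sum => l _.
    by rewrite normrM /u /v; case: ifP; lra.
  rewrite lerD2l; under [leRHS]eq_bigr do rewrite mulr_sumr.
  rewrite exchange_big /= !big_seq; apply: ler_sum => l; rewrite mem_iota => /= lm.
  apply: (le_trans (ler_wpM2l (normr_ge0 (a l)) (ub l j lm))).
  by rewrite mulr_sumr; under eq_bigr do rewrite mulrCA.
rewrite lerD//.
  apply: (le_trans (wsum_sum hw _ _ _ _)).
  apply: (@le_trans _ _ (\sum_(l < m) `|a l| * (N%:R * t + e))).
    rewrite sum_iota; apply: ler_sum => l _.
    by rewrite wsumZ normr_id ler_wpM2l// vb.
  have Nt0 : 0 <= N%:R * t + e by apply: le_trans (vb 0%N m0); rewrite wsum_ge0.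
  rewrite -mulr_suml; apply: (le_trans (ler_wpM2r Nt0 sum_abs_le_lnorm)).
  have := ler_wpM2r na mNe; lra.
apply: (le_trans (wsum_sum hw _ _ _ _)).
apply: (@le_trans _ _ (\sum_(q < D) 2 * t * (wpart w (c q) * lnorm w a))).
  rewrite sum_iota; apply: ler_sum => q _.
  have t2 : 0 <= 2 * t by have := t0; lra.
  rewrite wsumZ ger0_norm// ler_wpM2l//.
  apply: wsum_dilation => //; first by move=> l lm; rewrite szc.
  move=> l l' lm lm' ll j jL.
  have sub l1 : (l1 < m)%N -> j \in L q l1 -> j \in level_set (ys l1) t.
    move=> lm1; rewrite (level_setP sw (ysf lm1) (qt q)).2 (level_setP sw (ysf lm1) t0).2.
    by apply: le_trans; rewrite ler_peMl ?ler1n// ltW.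
  by apply: contra (ysd lm lm' ll (sub l lm jL)); exact: sub.
have -> : \sum_(q < D) 2 * t * (wpart w (c q) * lnorm w a) =
    2 * lnorm w a * (t * \sum_(q < D) wpart w (c q)).
  by rewrite !mulr_sumr; apply: eq_bigr => q _; ring.
(* All blocks share the sizes [c q], so block 0, of norm at most 1, already bounds [t] times the sum
   of the [wpart w (c q)] by 1. *)
have := level_lower sw D (ysf m0) t0.
rewrite (eq_bigr (fun q : 'I_D => wpart w (c q))); last by move=> q _; rewrite szc.
move=> /le_trans/(_ (ys1 _ m0)).
set X := t * _ => X1; have := ler_wpM2l na X1; lra.
Qed.

(** The index [jj l] lies in the level set of block [l], hence outside the others, where the blocks
    stay below [t]. Thus the combination at [jj l] has modulus at least [h * |a l|] up to an error
    [m * t] times the norm of [a]. Over at most [m] ranks the errors sum to at most [h / 2] times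
    that norm, which is absorbed on the left. *)
Lemma block_lower (h : R) (jj : nat -> nat) : 
  (forall l, (l < m)%N -> h <= `|ys l (jj l)|) ->
  t <= h -> m%:R * m%:R * t <= h / 2 ->
  lfinite w (fun j => \sum_(l < m) a l * ys l j) ->
  h * lnorm w a <= 2 * lnorm w (fun j => \sum_(l < m) a l * ys l j).
Proof.
move=> hjj th mt; set z := (fun j => _) => fz.
have inL l : (l < m)%N -> jj l \in level_set (ys l) t.
  by move=> lm; rewrite (level_setP sw (ysf lm) t0).2 (le_trans th)// hjj.
have off l l' : (l < m)%N -> (l' < m)%N -> l != l' -> `|ys l' (jj l)| <= t.
  move=> lm lm' ll; have := ysd lm lm' ll (inL l lm).
  by rewrite (level_setP sw (ysf lm') t0).2 -ltNge => /ltW.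
have jinj : {in [pred l | l < m]%N &, injective jj}.
  move=> l l'; rewrite !inE => lm lm' E; apply/eqP/negP => /negP ll.
  by have := ysd lm lm' ll (inL l lm); rewrite E inL.
suff : lnorm w a <= (lnorm w z + h / 2 * lnorm w a) / h.
  by rewrite ler_pdivlMr ?(lt_le_trans t0)//; lra.
apply: lnorm_le => // F uF; rewrite ler_pdivlMr ?(lt_le_trans t0)//.
apply: (@le_trans _ _ (wsum w a 0 (seq.filter (fun l => l < m)%N F) * h)).
  rewrite ler_wpM2r ?(le_trans (ltW t0))//; apply: wsum_support => //.
  by move=> j; rewrite -leqNgt => /am.
set G := seq.filter _ F; have uG : uniq G by rewrite filter_uniq.
have Gm l : l \in G -> (l < m)%N by rewrite mem_filter => /andP[].
have sG : (size G <= m)%N.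
  rewrite -(size_iota 0 m) uniq_leq_size// => l /Gm; by rewrite mem_iota.
have := @wsum_le_lnorm _ _ hw z (map jj G) fz; rewrite wsum_map.
move=> /(_ _)/wrap[].
  by rewrite map_inj_in_uniq// => l l' /Gm lm /Gm lm'; exact: jinj.
move=> hz; apply: (@le_trans _ _ (wsum w (z \o jj) 0 G + wsum w (fun=> m%:R * lnorm w a * t) 0 G)).
  have -> : wsum w a 0 G * h = wsum w (fun l => h * a l) 0 G.
    by rewrite wsumZ mulrC ger0_norm// (le_trans (ltW t0)).
  apply: le_trans (_ : wsum w (fun l => `|z (jj l)| + m%:R * lnorm w a * t) 0 G <= _); last first.
    apply: le_trans (wsumD hw _ _ _ _) _; rewrite lerD2r; apply: ler_wsum => // l _.
    by rewrite normr_id.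
  apply: ler_wsum => // l /Gm lm; set E := m%:R * _ * _.
  have E0 : 0 <= E by rewrite mulr_ge0 ?mulr_ge0// ltW.
  rewrite [leRHS]ger0_norm ?addr_ge0// /z.
  rewrite (bigD1 (Ordinal lm)) //=; set X := \sum_(i < m | _) _.
  have XE : `|X| <= E.
    apply: (@le_trans _ _ (\sum_(i < m | i != Ordinal lm) `|a i| * t)).
      apply: (le_trans (ler_norm_sum _ _ _)); apply: ler_sum => i il.
      rewrite normrM ler_wpM2l// off//; apply: contra il => /eqP il.
      by apply/eqP/val_inj.
    rewrite -mulr_suml /E ler_wpM2r ?(ltW t0)//; apply: le_trans sum_abs_le_lnorm.
    by rewrite [leRHS](bigD1 (Ordinal lm))//= lerDr.
  have := ler_normB (a l * ys l (jj l) + X) X; rewrite addrK [in leLHS]normrM.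
  have -> : `|h * a l| = h * `|a l| by rewrite normrM ger0_norm// (le_trans (ltW t0)).
  have := ler_wpM2l (normr_ge0 (a l)) (hjj l lm).
  lra.
rewrite lerD//; apply: (@le_trans _ _ (m%:R * (m%:R * lnorm w a * t))).
  apply: (@le_trans _ _ ((size G)%:R * (m%:R * lnorm w a * t))).
    apply: wsum_le_size => //; first by rewrite mulr_ge0 ?mulr_ge0// ltW.
    by move=> j _; rewrite ger0_norm// mulr_ge0 ?mulr_ge0// ltW.
  by rewrite ler_wpM2r ?ler_nat ?mulr_ge0 ?mulr_ge0// ltW.
have -> : m%:R * (m%:R * lnorm w a * t) = (m%:R * m%:R * t) * lnorm w a by ring.
by rewrite ler_wpM2r.
Qed.

End DisjointBlocks.

(** * The direct sum and its coordinate and rank functionals *)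

Section DirectSum.
Variables (R : realType) (n : nat) (w : nat -> nat -> R).
Hypothesis sw : forall i, submult_weight (w i).
Implicit Types (x y : E R n) (i : 'I_n).

Let hw i := submult_weight_decreasing (sw i).

Lemma normX_ge0 x : 0 <= normX w x.
Proof. exact: bigmax_ge_id. Qed.

Lemma lnorm_le_normX x i : lnorm (w i) (x i) <= normX w x.
Proof. exact: (le_bigmax_cond _ (fun i : 'I_n => fine (lorentz_norm (w i) (x i)))). Qed.

Lemma normX_le x (C : R) : 0 <= C -> (forall i, lnorm (w i) (x i) <= C) ->
  normX w x <= C.
Proof. by move=> C0 h; apply: bigmax_le => // i _; exact: h. Qed.

Lemma coord_le_normX x i j : inX w x -> `|x i j| <= normX w x.
Proof.
by move=> fx; exact: le_trans (coord_le_lnorm (hw i) j (fx i)) (lnorm_le_normX x i).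
Qed.

Lemma inX_lin (c : R) x y : inX w x -> inX w y ->
  inX w (fun i j => c * x i j + y i j).
Proof. by move=> fx fy i; exact: (lfiniteD (hw i) (lfiniteZ (hw i) c (fx i)) (fy i)). Qed.

Lemma inX0 : inX w ((fun _ _ => 0) : E R n).
Proof. by move=> i; exact: (@lfinite_finsupp _ _ (hw i) (fun=> 0) 0). Qed.

Lemma inX_sum m (a : nat -> R) (x : nat -> E R n) :
  (forall l, inX w (x l)) -> inX w (fun i j => \sum_(l < m) a l * x l i j).
Proof.
move=> fx; elim: m => [|m IH].
  by rewrite (_ : (fun _ _ => _) = (fun _ _ => 0) :> E R n); [exact: inX0|
    apply/funext => i; apply/funext => j; rewrite big_ord0].
rewrite (_ : (fun _ _ => _) =
    fun i j => a m * x m i j + \sum_(l < m) a l * x l i j); first exact: inX_lin.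
by apply/funext => i; apply/funext => j; rewrite big_ord_recr /= addrC.
Qed.

Lemma bdd_functional_coord i j : bdd_functional w (fun x : E R n => x i j).
Proof.
split=> //; exists 1 => x fx; rewrite mul1r; exact: coord_le_normX.
Qed.

Lemma weakly_null_coord (x : nat -> E R n) i j (e : R) : weakly_null w x -> 0 < e ->
  exists K, forall k, (K <= k)%N -> `|x k i j| < e.
Proof.
move=> /(_ _ (bdd_functional_coord i j)) /cvgr0Pnorm_lt h /h[K _ hK].
by exists K => k; exact: hK.
Qed.

Lemma weakly_null_coords (x : nat -> E R n) i (J : seq nat) (e : R) :
  weakly_null w x -> 0 < e ->
  exists K, forall k, (K <= k)%N -> {in J, forall j, `|x k i j| < e}.
Proof.
move=> wn e0; elim: J => [|j J [K hK]]; first by exists 0%N.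
have [K' hK'] := weakly_null_coord i j wn e0.
exists (maxn K K') => k; rewrite geq_max => /andP[Kk K'k] l.
by rewrite inE => /orP[/eqP ->|]; [exact: hK'|exact: hK].
Qed.

Section RankFunctional.
Variables (i : 'I_n) (g : nat -> nat) (s : nat -> R).
Hypotheses (g_inj : injective g) (s_le1 : forall r, `|s r| <= 1).

Let u x (r : nat) : R := s r * (w i r * x i (g r)).

(** The series converges absolutely with a sum of at most the norm, because its partial sums of
    moduli are bounded by weighted sums along the injection [g]. *)
Definition rank_functional x : R := limn (series (u x)).

Let sum_norm_u x M : inX w x ->
  \sum_(0 <= r < M) `|u x r| <= lnorm (w i) (x i).
Proof.
move=> fx; apply: (@le_trans _ _ (wsum (w i) (x i) 0 (map g (iota 0 M)))).
  rewrite wsum_iota add0n; apply: ler_sum => r _.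
  rewrite /u !normrM [`|w i r|]ger0_norm ?(weight_ge0 (hw i))//.
  by rewrite ler_piMl// mulr_ge0// (weight_ge0 (hw i)).
by apply: (wsum_le_lnorm (hw i) (fx i)); rewrite map_inj_uniq ?iota_uniq.
Qed.

Lemma cvg_rank_functional x : inX w x -> cvgn (series (u x)).
Proof.
move=> fx; apply: normed_cvg; apply: nondecreasing_is_cvgn.
  by apply: nondecreasing_series => r _ _ /=.
exists (lnorm (w i) (x i)) => _ [M _ <-] /=.
by rewrite /series /=; exact: sum_norm_u.
Qed.

Lemma bdd_rank_functional : bdd_functional w rank_functional.
Proof.
split=> [c x y fx fy|].
  rewrite /rank_functional (_ : u _ = c *: u x + u y); last first.
    by apply/funext => r; rewrite /u !fctE /GRing.scale /=; ring.
  have cx := cvg_rank_functional fx; have cy := cvg_rank_functional fy.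
  have cZ := @is_cvg_seriesZ _ (u x) c cx.
  by rewrite (lim_seriesD cZ cy) (lim_seriesZ c cx).
exists 1 => x fx; rewrite mul1r; apply: le_trans (lnorm_le_normX x i).
have cx := cvg_rank_functional fx.
rewrite /rank_functional -lim_norm//; apply: limr_le; first exact: is_cvg_norm.
apply: nearW => M /=; apply: (le_trans (ler_norm_sum _ _ _)).
exact: sum_norm_u.
Qed.

Lemma rank_functional_ge x (c : R) N : inX w x ->
  (forall M, (N <= M)%N -> c <= \sum_(0 <= r < M) s r * (w i r * x i (g r))) ->
  c <= rank_functional x.
Proof.
move=> fx h; apply: limr_ge; first exact: cvg_rank_functional.
by exists N => // M; exact: h.
Qed.

End RankFunctional.
End DirectSum.

(** * Gliding hump: uniformly small tails of weakly null sequences *)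

Section UniformTail.
Variables (R : realType) (n : nat) (w : nat -> nat -> R).
Hypothesis sw : forall i, submult_weight (w i).
Variables (x : nat -> E R n) (i : 'I_n).
Hypotheses (fx : forall k, inX w (x k)) (wnx : weakly_null w x).

Let hw := submult_weight_decreasing (sw i).

Variable e : R.
Hypothesis e0 : 0 < e.
(** The negation of the uniform tail bound for component [i], to be refuted. *)
Hypothesis big_tail : forall N K, exists k, (K <= k)%N /\
  exists F, uniq F /\ e < wsum (w i) (x k i) N F.

(** Far enough out, [x k] is tiny on the used indices [J] by weak nullity, yet has a tail sum above
    [e] from rank [size J]. Removing [J] from that tail costs at most [e / 4]. *)
Lemma hump_extension (J : seq nat) (K : nat) : uniq J -> exists k H,
  [/\ (K <= k)%N, H != [::] /\ uniq (J ++ H),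
      {in J, forall j, `|x k i j| < e / 4 / (size J).+1%:R},
      e * 3 / 4 <= wsum (w i) (x k i) (size J) H &
      forall F, uniq F -> wsum (w i) (x k i) (size J + size H) F <= e / 8].
Proof.
move=> uJ; have d0 : 0 < e / 4 / (size J).+1%:R by rewrite !divr_gt0.
have [K' hK'] := weakly_null_coords sw i J wnx d0.
have [k [Kk [F [uF hF]]]] := big_tail (size J) (maxn K K').
move: Kk; rewrite geq_max => /andP[Kk /hK' small].
have [|N0 hN0] := @wsum_tail_small _ _ (sw i) (x k i) (e / 8) (fx k i).
  by rewrite divr_gt0.
pose F1 := seq.filter (fun j => j \notin J) F.
pose b := (\max_(j <- J ++ F1) j).+1.
have bP j : j \in J ++ F1 -> (j < b)%N by move=> jJ; rewrite ltnS; exact: leq_bigmax_seq.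
(* The padding [iota b N0.+1] consists of fresh indices. It makes the list nonempty and pushes the
   next free rank past [N0], where the tail of this term is at most [e / 8]. *)
exists k, (F1 ++ iota b N0.+1); split=> //.
- split; first by rewrite -size_eq0 size_cat size_iota addnS.
  rewrite catA cat_uniq iota_uniq andbT cat_uniq uJ filter_uniq// !andbT andTb; apply/andP; split.
    by apply/hasPn => j; rewrite mem_filter => /andP[].
  apply/hasPn => j; rewrite mem_iota => /andP[bj _]; apply/negP => /bP.
  by rewrite ltnNge bj.
- rewrite wsum_cat; apply: ler_wpDr; first exact: wsum_ge0.
  have := wsum_filter hw (fun j => j \notin J) (x k i) (size J) F.
  rewrite -/F1; set F2 := seq.filter _ F.
  suff : wsum (w i) (x k i) (size J) F2 <= e / 4 by lra.
  apply: (@le_trans _ _ ((size F2)%:R * (e / 4 / (size J).+1%:R))).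
    apply: wsum_le_size => //; first exact: ltW.
    by move=> j; rewrite mem_filter /= negbK => /andP[/small/ltW].
  rewrite mulrCA ler_piMr ?divr_ge0 ?ltW// ?ltr_pdivrMr// mul1r ltr_nat ltnS.
  apply: uniq_leq_size; first by rewrite filter_uniq.
  by move=> j; rewrite mem_filter /= negbK => /andP[].
- move=> G uG; apply: le_trans (hN0 G uG); apply: wsum_shift => //.
  by rewrite size_cat size_iota; lia.
Qed.

(* Gliding hump: concatenating the extensions assigns each rank [r] its own index
   [g r] and sign [s r], and the functional [sum_r s r * w r * y (g r)] stays away
   from 0 along a subsequence of [x]. *)
Lemma uniform_tail_absurd : False.
Proof.
(* A state holds the pairs (index, sign) assigned to the ranks so far and the position in [x] of the
   last term used. *)
pose T := (seq (nat * R) * nat)%type.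
pose d0 : nat * R := (0%N, 0).
pose inv (st : T) := uniq (map fst st.1) /\ forall p, p \in st.1 -> `|p.2| <= 1.
pose step (st st' : T) := inv st -> [/\ inv st', (st.2 < st'.2)%N &
  exists H : seq nat, [/\ H != [::],
     st'.1 = st.1 ++ [seq (j, Num.sg (x st'.2 i j)) | j <- H],
     {in map fst st.1, forall j, `|x st'.2 i j| < e / 4 / (size st.1).+1%:R},
     e * 3 / 4 <= wsum (w i) (x st'.2 i) (size st.1) H &
     forall F, uniq F -> wsum (w i) (x st'.2 i) (size st'.1) F <= e / 8]].
have [phi hphi] : {phi : T -> T & forall st, step st (phi st)}.
  apply: choice => -[G k]; have [[/= uG sG]|no] := pselect (inv (G, k)); last first.
    by exists (G, k) => /no.
  have [k' [H [kk' [H0 uGH] h1 h2 h3]]] := hump_extension k.+1 uG.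
  rewrite size_map in h1 h2 h3.
  exists (G ++ [seq (j, Num.sg (x k' i j)) | j <- H], k') => _; split=> //=.
    split=> /=; first by rewrite map_cat -map_comp (eq_map (g := id)) ?map_id.
    move=> p; rewrite mem_cat => /orP[/sG//|/mapP[j _ ->]] /=.
    by rewrite normr_sg lern1 leq_b1.
  by exists H; split=> //; rewrite size_cat size_map.
pose st l := iter l phi ([::], 0%N).
have inv_st l : inv (st l).
  by elim: l => [|l IH]; [split|have [] := hphi (st l) IH].
have stS l := hphi (st l) (inv_st l).
pose G l := (st l).1; pose kk l := (st l).2.
have kk_ge l : (l <= kk l)%N.
  elim: l => // l IH; have [_ h _] := stS l; exact: leq_ltn_trans IH h.
have GS l : exists2 P, P != [::] & G l.+1 = G l ++ P.
  have [_ _ [H [H0 EG _ _ _]]] := stS l.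
  exists [seq (j, Num.sg (x (st l.+1).2 i j)) | j <- H]; last exact: EG.
  by rewrite -size_eq0 size_map size_eq0.
have sizeG l : (l <= size (G l))%N.
  elim: l => // l IH; have [[//|p P] _ ->] := GS l.
  by rewrite size_cat /=; lia.
have sizeGS l : (size (G l) <= size (G l.+1))%N.
  by have [P _ ->] := GS l; rewrite size_cat leq_addr.
have nthG l l' r : (l <= l')%N -> (r < size (G l))%N -> nth d0 (G l') r = nth d0 (G l) r.
  move=> /subnKC <- rl; elim: (l' - l)%N => [|t IH]; first by rewrite addn0.
  rewrite addnS; have [P _ ->] := GS (l + t)%N; rewrite nth_cat IH ifT//.
  apply: (leq_trans rl); elim: t {IH} => [|t IH]; first by rewrite addn0.
  by rewrite addnS (leq_trans IH).
(* Each stage adds at least one pair, so rank [r] is settled by stage [r.+1] and never changes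
   later. *)
pose pr r := nth d0 (G r.+1) r.
have prE l r : (r < size (G l))%N -> pr r = nth d0 (G l) r.
  move=> rl; have [lr|/ltnW rl'] := leqP l r.+1; first exact: nthG.
  by rewrite /pr (nthG r.+1 l).
pose g r := (pr r).1; pose s r := (pr r).2.
have gE l r : (r < size (G l))%N -> g r = nth 0%N (map fst (G l)) r.
  by move=> rl; rewrite /g (prE l)// (nth_map d0).
have g_inj : injective g.
  move=> r r'; pose l := (maxn r r').+1.
  have rl : (r < size (G l))%N by apply: leq_trans (sizeG l); rewrite ltnS leq_maxl.
  have rl' : (r' < size (G l))%N by apply: leq_trans (sizeG l); rewrite ltnS leq_maxr.
  rewrite (gE l)// (gE l)// => /eqP.
  by rewrite nth_uniq ?size_map ?(inv_st l).1// => /eqP.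
have s_le1 r : `|s r| <= 1.
  by rewrite /s /pr; apply: (inv_st r.+1).2; rewrite mem_nth//.
(* The old ranks contribute at least [- e / 4], the hump at least [3 * e / 4] thanks to the signs,
   and the later ranks at least [- e / 8]. *)
have low l : e / 4 <= rank_functional w i g s (x (kk l.+1)).
  apply: (@rank_functional_ge _ _ _ sw i g s g_inj s_le1 _ _ (size (G l.+1))) => //.
  move=> M hM; have [_ _ [H [_ EG small hump tail]]] := stS l.
  rewrite -/(kk l.+1) -/(G l) -/(G l.+1) in EG small hump tail.
  set y := x (kk l.+1) i in EG small hump tail *.
  rewrite (big_cat_nat (leq0n _) hM)//= (big_cat_nat (leq0n _) (sizeGS l))//=.
  set S1 := \sum_(0 <= r < size (G l)) _.
  set S2 := \sum_(size (G l) <= r < size (G l.+1)) _.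
  set S3 := \sum_(size (G l.+1) <= r < M) _.
  have wpos r := weight_ge0 hw r.
  have h1 : `|S1| <= e / 4.
    apply: (le_trans (ler_norm_sum _ _ _)).
    apply: (@le_trans _ _ (\sum_(0 <= r < size (G l)) e / 4 / (size (G l)).+1%:R)).
      rewrite big_nat [leRHS]big_nat; apply: ler_sum => r /= rl.
      have gr : g r \in map fst (G l) by rewrite (gE l)// mem_nth// size_map.
      rewrite normrM; apply: le_trans (ltW (small _ gr)).
      rewrite (le_trans (ler_piMl _ (s_le1 r)))// normrM ler_piMl//.
      by rewrite ger0_norm// weight_le1.
    rewrite sumr_const_nat subn0 -[leLHS]mulr_natr [leLHS]mulrAC ler_pdivrMr//.
    by rewrite ler_pM2l ?divr_gt0// ler_nat.
  have sizeE : size (G l.+1) = (size (G l) + size H)%N by rewrite EG size_cat size_map.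
  have h2 : e * 3 / 4 <= S2.
    apply: (le_trans hump); rewrite le_eqVlt; apply/orP; left; apply/eqP.
    have EH : H = map g (iota (size (G l)) (size H)).
      apply: (@eq_from_nth _ 0%N) => [|r rH]; first by rewrite size_map size_iota.
      rewrite (nth_map 0%N) ?size_iota// nth_iota// (gE l.+1) ?sizeE ?ltn_add2l//.
      rewrite EG map_cat nth_cat !size_map ltnNge leq_addr /= addKn.
      by rewrite -map_comp (eq_map (g := id)) ?map_id.
    rewrite {1}EH wsum_iota -sizeE /S2 big_nat [RHS]big_nat; apply: eq_bigr => r /andP[lr rl].
    have -> : s r = Num.sg (y (g r)).
      rewrite /s /g (prE l.+1)// EG nth_cat ltnNge lr /= (nth_map 0%N)//=.
      by rewrite ltn_subLR// -sizeE.
    by rewrite mulrCA -normrEsg.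
  have h3 : `|S3| <= e / 8.
    have uF : uniq (map g (iota (size (G l.+1)) (M - size (G l.+1)))).
      by rewrite map_inj_uniq ?iota_uniq.
    apply: le_trans (tail _ uF); rewrite wsum_iota subnKC//.
    apply: (le_trans (ler_norm_sum _ _ _)); apply: ler_sum => r _.
    by rewrite normrM (le_trans (ler_piMl _ (s_le1 r)))// normrM ger0_norm.
  have := ler_norm (- S1); have := ler_norm (- S3); rewrite !normrN; have := e0; lra.
have bf := bdd_rank_functional sw i g_inj s_le1.
move: (wnx bf) => /cvgr0Pnorm_lt /(_ (e / 4)) /(_ _)/wrap[]; first by rewrite divr_gt0.
move=> [K _ hK]; have := hK (kk K.+1) (ltnW (kk_ge K.+1)) => /=.
by apply/negP; rewrite -leNgt (le_trans (low K))// ler_norm.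
Qed.

End UniformTail.

Lemma weakly_null_tail (R : realType) (n : nat) (w : nat -> nat -> R)
    (x : nat -> E R n) (i : 'I_n) (e : R) :
  (forall i, submult_weight (w i)) -> (forall k, inX w (x k)) -> weakly_null w x ->
  0 < e -> exists N K, forall k, (K <= k)%N ->
    forall F, uniq F -> wsum (w i) (x k i) N F <= e.
Proof.
move=> sw fx wn e0; apply: contrapT => no.
apply: (@uniform_tail_absurd _ _ _ sw x i fx wn e e0) => N K.
apply: contrapT => no'; apply: no; exists N, K => k Kk F uF.
rewrite leNgt; apply/negP => lt; apply: no'; exists k; split=> //; by exists F.
Qed.

(** * Polynomials as carriers of abstract spreading models *)

Record poly_norm (R : realType) := PolyNorm {
  poly_norm_fun : {poly R} -> R;
  poly_normD : forall p q,
    poly_norm_fun (p + q) <= poly_norm_fun p + poly_norm_fun q;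
  poly_normZ : forall (c : R) p, poly_norm_fun (c *: p) = `|c| * poly_norm_fun p;
  poly_norm_eq0 : forall p, poly_norm_fun p = 0 -> p = 0 }.

(** Polynomials are the finitely supported sequences and monomials their unit vectors. The parameter
    [d] gives each norm its own type, so that different normed structures coexist. *)
Definition normed_poly (R : realType) (d : poly_norm R) : Type := {poly R}.

HB.instance Definition _ (R : realType) (d : poly_norm R) :=
  GRing.Lmodule.copy (normed_poly d) {poly R}.

HB.instance Definition _ (R : realType) (d : poly_norm R) :=
  @Lmodule_isNormed.Build R (normed_poly d) (@poly_norm_fun R d)
    (@poly_normD R d) (@poly_normZ R d) (@poly_norm_eq0 R d).

(** * Maxima of Lorentz norms and the diagonal unit vectors *)

Section MaxLorentzNorm.
Variables (R : realType) (n : nat) (w : nat -> nat -> R).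
Hypothesis sw : forall i, submult_weight (w i).
Implicit Types (A B : {set 'I_n}) (a : seq R).

Let hw i := submult_weight_decreasing (sw i).

(** For nonempty [A], this is the norm representing the class that the order isomorphism attaches to
    [A]. *)
Definition maxnorm A a : R := \big[Num.max/0]_(i in A) lnorm (w i) (fun j => a`_j).

Lemma lfinite_seq i a : lfinite (w i) (fun j => a`_j).
Proof.
apply: (@lfinite_finsupp _ _ (hw i) _ (size a)) => j sj; exact: nth_default.
Qed.

Lemma maxnorm_ge0 A a : 0 <= maxnorm A a.
Proof. exact: bigmax_ge_id. Qed.

Lemma lnorm_le_maxnorm A a (i : 'I_n) : i \in A ->
  lnorm (w i) (fun j => a`_j) <= maxnorm A a.
Proof.
by move=> iA; exact: (le_bigmax_cond _ (fun i : 'I_n => lnorm (w i) (fun j => a`_j))).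
Qed.

Lemma maxnorm_le A a (C : R) : 0 <= C ->
  (forall i : 'I_n, i \in A -> lnorm (w i) (fun j => a`_j) <= C) -> maxnorm A a <= C.
Proof. by move=> C0 h; apply: bigmax_le. Qed.

Lemma coord_le_maxnorm A a j : A != finset.set0 -> `|a`_j| <= maxnorm A a.
Proof.
move=> /set0Pn[i iA]; apply: le_trans (lnorm_le_maxnorm a iA).
exact: (coord_le_lnorm (hw i) j (lfinite_seq i a)).
Qed.

Lemma maxnormD A (p q : {poly R}) : maxnorm A (p + q)%R <= maxnorm A p + maxnorm A q.
Proof.
apply: maxnorm_le; first by rewrite addr_ge0 ?maxnorm_ge0.
move=> i iA; rewrite (_ : (fun j => _) = fun j => p`_j + q`_j); last first.
  by apply/funext => j; rewrite coefD.
rewrite (le_trans (lnormD (hw i) (lfinite_seq i p) (lfinite_seq i q)))//.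
by rewrite lerD ?lnorm_le_maxnorm.
Qed.

Lemma maxnorm_scale A (c : R) a b : (forall j, b`_j = c * a`_j) ->
  maxnorm A b = `|c| * maxnorm A a.
Proof.
move=> ba; have E i : lnorm (w i) (fun j => b`_j) = `|c| * lnorm (w i) (fun j => a`_j).
  rewrite -(lnormZ (hw i) c (lfinite_seq i a)); congr lnorm.
  by apply/funext => j; rewrite ba.
rewrite /maxnorm; under eq_bigr do rewrite E.
elim/big_ind2: _ => //; first by rewrite mulr0.
by move=> x1 x2 y1 y2 -> ->; rewrite maxr_pMr.
Qed.

Lemma maxnormZ A (c : R) (p : {poly R}) : maxnorm A (c *: p) = `|c| * maxnorm A p.
Proof. by apply: maxnorm_scale => j; rewrite coefZ. Qed.

Lemma maxnorm_eq0 A (p : {poly R}) : A != finset.set0 -> maxnorm A p = 0 -> p = 0.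
Proof.
move=> A0 p0; apply/polyP => j; rewrite coef0; apply/eqP.
by rewrite -normr_le0; have := coord_le_maxnorm p j A0; rewrite p0.
Qed.

Definition maxnorm_poly_norm A (A0 : A != finset.set0) : poly_norm R :=
  @PolyNorm R (fun p => maxnorm A p) (maxnormD A) (maxnormZ A)
    (fun p => @maxnorm_eq0 A p A0).

Lemma smnorm_monomials A (A0 : A != finset.set0) :
  maxnorm A = smnorm (fun m => 'X^m : normed_poly (maxnorm_poly_norm A0)).
Proof.
apply/funext => a; rewrite /smnorm.
have -> : \sum_(m < size a) a`_m *: ('X^m : normed_poly (maxnorm_poly_norm A0)) =
    \poly_(m < size a) a`_m :> {poly R} by rewrite poly_def.
rewrite [RHS](_ : _ = maxnorm A (\poly_(m < size a) a`_m))//.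
rewrite [RHS](@maxnorm_scale A 1 a) ?normr1 ?mul1r// => j; rewrite coef_poly mul1r.
by case: ltnP => // /(nth_default 0) ->.
Qed.

Lemma maxnormS A B a : A \subset B -> maxnorm A a <= maxnorm B a.
Proof.
move=> AB; apply: maxnorm_le; first exact: maxnorm_ge0.
by move=> i iA; apply: lnorm_le_maxnorm; exact: (fintype.subsetP AB).
Qed.

Lemma lnorm_ones i m : lnorm (w i) (fun j => (nseq m (1 : R))`_j) = wpart (w i) m.
Proof.
apply/eqP; rewrite eq_le; apply/andP; split.
  apply: (lnorm_le (hw i)) => F uF.
  apply: le_trans (_ : _ <= wsum (w i) (ind R (iota 0 m)) 0 F) _.
    apply: (ler_wsum (hw i)) => j _.
    by rewrite nth_nseq /ind mem_iota /= add0n; case: ltnP; rewrite ?normr1 ?normr0.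
  by have := wsum_ind_le (sw i) (iota 0 m) uF; rewrite size_iota.
have := @wsum_ge_wpart _ _ (hw i) (fun j => (nseq m (1 : R))`_j) (iota 0 m) 1.
rewrite size_iota mulr1 => /(_ _)/wrap[].
  by move=> j; rewrite mem_iota /= add0n => jm; rewrite nth_nseq jm normr1.
move=> /le_trans; apply.
exact: (wsum_le_lnorm (hw i) (lfinite_seq i (nseq m 1)) (iota_uniq 0 m)).
Qed.

(** Rearrangement invariance: after discarding indices with zero entries, [k] and its inverse [ki]
    on the image carry the index lists of one side to those of the other. *)
Lemma lnorm_spread i (a : nat -> R) m (k : nat -> nat) :
  (forall j, (m <= j)%N -> a j = 0) -> {in [pred l | l < m]%N &, injective k} ->
  lnorm (w i) (fun j => \sum_(l < m) a l * (j == k l)%:R) = lnorm (w i) a.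
Proof.
move=> am kinj; set b := fun j => _.
have fa : lfinite (w i) a := lfinite_finsupp (hw i) am.
have bk l : (l < m)%N -> b (k l) = a l.
  move=> lm; rewrite /b (bigD1 (Ordinal lm))//= eqxx mulr1 big1 ?addr0// => l' ll'.
  case: eqP => [/kinj E|_]; rewrite ?mulr0//; case/eqP: ll'; apply/val_inj => /=.
  by rewrite E// inE.
pose im := map k (iota 0 m).
have b0 j : ~~ (j \in im) -> b j = 0.
  move=> jim; rewrite /b big1// => l _; case: eqP => [E|_]; rewrite ?mulr0//.
  by case/mapP: jim; exists (val l) => //; rewrite mem_iota /=.
pose ki j := index j im.
have kiP j : j \in im -> (ki j < m)%N /\ k (ki j) = j.
  move=> jim; have lt : (ki j < m)%N by rewrite -[m](size_iota 0) -(size_map k) index_mem.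
  split=> //; have := nth_index 0%N jim; rewrite (nth_map 0%N) ?size_iota//.
  by rewrite nth_iota.
have le1 F : uniq F -> wsum (w i) b 0 F <= lnorm (w i) a.
  move=> uF; apply: (le_trans (@wsum_support _ _ (hw i) (mem im) b 0 F b0)).
  set F1 := seq.filter _ F; have uF1 : uniq F1 by rewrite filter_uniq.
  have inF1 j : j \in F1 -> j \in im by rewrite mem_filter => /andP[].
  have E : map k (map ki F1) = F1.
    by rewrite -map_comp -[RHS]map_id; apply/eq_in_map => j /inF1/kiP[].
  rewrite -E wsum_map (@eq_wsum _ _ _ a); last first.
    by move=> _ /mapP[j /inF1/kiP[jm _] ->]; rewrite /= bk.
  apply: (wsum_le_lnorm (hw i) fa); apply: (@map_uniq _ _ k); by rewrite E.
have fb : lfinite (w i) b := lfiniteP (hw i) le1.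
apply/eqP; rewrite eq_le (lnorm_le (hw i) le1) /=.
apply: (lnorm_le (hw i)) => F uF.
apply: (le_trans (@wsum_support _ _ (hw i) (fun l => l < m)%N a 0 F _)).
  by move=> j; rewrite -leqNgt => /am.
set F1 := seq.filter _ F; have inF1 l : l \in F1 -> (l < m)%N by rewrite mem_filter => /andP[].
rewrite (@eq_wsum _ _ _ (b \o k)); last by move=> l /inF1 lm; rewrite /= bk.
rewrite -wsum_map; apply: (wsum_le_lnorm (hw i) fb).
rewrite map_inj_in_uniq ?filter_uniq// => l l' /inF1 lm /inF1 lm'; exact: kinj.
Qed.

Definition diag_unit A (k : nat) : E R n := fun i j => if i \in A then (j == k)%:R else 0.

Lemma inX_diag_unit A k : inX w (diag_unit A k).
Proof.
move=> i; rewrite /diag_unit; apply: (@lfinite_finsupp _ _ (hw i) _ k.+1) => j kj.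
by case: ifP => // _; rewrite gtn_eqF.
Qed.

Lemma lnorm0 i : lnorm (w i) (fun=> 0 : R) = 0.
Proof.
apply/eqP; rewrite eq_le lnorm_ge0// andbT; apply: (lnorm_le (hw i)) => F uF.
by have := finsupp_bound (hw i) (y := fun=> 0) (m := 0) (fun _ _ => erefl) uF; rewrite big_ord0.
Qed.

Lemma normX_comb_diag A a (k : nat -> nat) :
  {in [pred l | l < size a]%N &, injective k} ->
  normX w (comb a (diag_unit A) k) = maxnorm A a.
Proof.
move=> kinj.
have E (i : 'I_n) : lnorm (w i) (comb a (diag_unit A) k i) =
    if i \in A then lnorm (w i) (fun j => a`_j) else 0.
  rewrite /comb /diag_unit; case: ifP => _.
    by apply: (lnorm_spread i (a := nth 0 a)) => // j; exact: nth_default.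
  rewrite -[RHS](lnorm0 i); congr lnorm; apply/funext => j.
  by rewrite big1// => l _; rewrite mulr0.
apply/eqP; rewrite eq_le; apply/andP; split.
  apply: normX_le; first exact: maxnorm_ge0.
  by move=> i; rewrite E; case: ifP => [iA|_]; [exact: lnorm_le_maxnorm|exact: maxnorm_ge0].
apply: maxnorm_le; first exact: normX_ge0.
by move=> i iA; have := lnorm_le_normX w (comb a (diag_unit A) k) i; rewrite E iA.
Qed.

Lemma normX_diag_unit A k : A != finset.set0 -> normX w (diag_unit A k) = 1.
Proof.
move=> /set0Pn[i iA].
have := @normX_comb_diag A [:: 1] (fun=> k).
have -> : comb [:: 1] (diag_unit A) (fun=> k) = diag_unit A k.
  by apply/funext => i'; apply/funext => j; rewrite /comb big_ord1 /= mul1r.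
move=> -> => [|[|?] [|?]]//; apply/eqP; rewrite eq_le; apply/andP; split.
  apply: maxnorm_le => // i' _; have := lnorm_ones i' 1; rewrite /= => ->.
  by rewrite /wpart big_ord1 (weight0 (hw i')).
apply: le_trans (coord_le_maxnorm (A := A) [:: 1] 0 _); first by rewrite /= normr1.
by apply/set0Pn; exists i.
Qed.

Lemma increasing_inj m (k : nat -> nat) :
  (forall i j, (i < j < m)%N -> (k i < k j)%N) ->
  {in [pred l | l < m]%N &, injective k}.
Proof.
move=> kmon l l'; rewrite !inE => lm lm' E; case: (ltngtP l l') => // lt.
  by have := kmon l l'; rewrite lt lm' E ltnn => /(_ isT).
by have := kmon l' l; rewrite lt lm E ltnn => /(_ isT).
Qed.

Lemma generates_diag A (A0 : A != finset.set0) :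
  generates_sm w (diag_unit A) (fun m => 'X^m : normed_poly (maxnorm_poly_norm A0)).
Proof.
exists (fun=> 0); split=> //; first exact: cvg_cst.
move=> a k _ kmon _; rewrite -smnorm_monomials (normX_comb_diag A (increasing_inj kmon)).
by rewrite addr0 invr1 !mul1r.
Qed.

(** The first [M0] weights are at most 1 and the later ones at most [w i M0]. Since the weights tend
    to 0, the fundamental function grows more slowly than any multiple of [M]. *)
Lemma wpart_le_split i M0 M : wpart (w i) M <= M0%:R + M%:R * w i M0.
Proof.
have W0 := weight_ge0 (hw i) M0.
elim: M => [|M IH]; first by rewrite /wpart big_ord0 mul0r addr0.
have [lt|le] := ltnP M M0.
  apply: (le_trans (wpart_le_nat (hw i) _)); rewrite -[leLHS]addr0 lerD ?ler_nat//.
  by rewrite mulr_ge0.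
rewrite wpartS -natr1 mulrDl mul1r addrA lerD//; exact: weight_le.
Qed.

Lemma weights_small (e : R) : 0 < e -> exists M0, forall i : 'I_n, w i M0 <= e.
Proof.
move=> e0; have [f hf] := @choice 'I_n nat (fun i N => w i N <= e)
  (fun i => submult_weight_cvg0 (sw i) e0).
exists (\max_(i < n) f i)%N => i; apply: le_trans (hf i).
by apply: (weight_le (hw i)); exact: leq_bigmax.
Qed.

(** If [f] had modulus at least [e] on infinitely many terms, a sum of [M] of them with suitable
    signs would have value at least [M * e], while its norm is at most the largest [wpart (w i) M],
    which is sublinear in [M]. *)
Lemma weakly_null_diag A : weakly_null w (diag_unit A).
Proof.
move=> f [flin [C0 fC0]]; apply/cvgr0Pnorm_lt => e e0.
pose C : R := `|C0| + 1; have Cpos : 0 < C by rewrite ltr_wpDl.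
have fC x : inX w x -> `|f x| <= C * normX w x.
  move=> fx; rewrite (le_trans (fC0 x fx))// ler_wpM2r ?normX_ge0//.
  by rewrite (le_trans (ler_norm _))// lerDl.
apply: contrapT => no.
have far K : exists k, (K <= k)%N /\ e <= `|f (diag_unit A k)|.
  apply: contrapT => noK; apply: no; exists K => // k /= Kk.
  by rewrite ltNge; apply/negP => ek; apply: noK; exists k.
pose Z (ks : seq nat) : E R n :=
  fun i j => \sum_(k <- ks) Num.sg (f (diag_unit A k)) * diag_unit A k i j.
have f0 : f (fun _ _ => 0) = 0.
  have := flin 1 _ _ (@inX0 _ n _ sw) (@inX0 _ n _ sw).
  have -> : (fun (_ : 'I_n) (_ : nat) => 1 * 0 + 0 : R) = fun _ _ => 0.
    by apply/funext => i; apply/funext => j; rewrite mulr0 addr0.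
  lra.
have ZS k ks : Z (k :: ks) =
    fun i j => Num.sg (f (diag_unit A k)) * diag_unit A k i j + Z ks i j.
  by apply/funext => i; apply/funext => j; rewrite /Z big_cons.
have Z0 : Z [::] = fun _ _ => 0.
  by apply/funext => i; apply/funext => j; rewrite /Z big_nil.
have ZX ks : inX w (Z ks).
  elim: ks => [|k ks IH]; first by rewrite Z0; exact: inX0.
  by rewrite ZS; apply: inX_lin => //; exact: inX_diag_unit.
have fZ ks : f (Z ks) = \sum_(k <- ks) `|f (diag_unit A k)|.
  elim: ks => [|k ks IH]; first by rewrite Z0 f0 big_nil.
  by rewrite ZS flin ?IH ?big_cons -?normrEsg//; exact: inX_diag_unit.
have nZ (ks : seq nat) : uniq ks -> forall i : 'I_n, lnorm (w i) (Z ks i) <= wpart (w i) (size ks).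
  move=> uks i; apply: (lnorm_le (hw i)) => F uF.
  apply: le_trans (wsum_ind_le (sw i) ks uF); apply: (ler_wsum (hw i)) => j _.
  rewrite /Z /diag_unit; case: (i \in A); last first.
    by rewrite big1 ?normr0// => k _; rewrite mulr0.
  rewrite /ind; have [jks|jks] := boolP (j \in ks); last first.
    rewrite big1_seq ?normr0// => k /= kks; case: eqP => [jk|_]; rewrite ?mulr0//.
    by rewrite jk kks in jks.
  rewrite (bigD1_seq j)//= eqxx mulr1 big1 ?addr0 ?normr1 ?normr_sg ?lern1 ?leq_b1//.
  by move=> k /negbTE kj; rewrite eq_sym kj mulr0.
have lists M : exists ks, [/\ uniq ks, size ks = M &
    {in ks, forall k, e <= `|f (diag_unit A k)|}].
  elim: M => [|M [ks [u s h]]]; first by exists [::].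
  have [k [hk ek]] := far (\max_(k <- ks) k).+1.
  exists (k :: ks); split=> //=; last 2 first.
  - by rewrite s.
  - by move=> l; rewrite inE => /orP[/eqP ->|/h].
  rewrite u andbT; apply/negP => kks; move: hk; rewrite ltnNge.
  by rewrite (leq_bigmax_seq _ kks).
(* Past rank [M0] the weights cost only [M * e / 2] after multiplication by [C]; the bound [B] below
   then makes the remaining [C * M0] smaller than [M * e / 2]. *)
have [|M0 hM0] := @weights_small (e / (2 * C)); first by rewrite divr_gt0// mulr_gt0.
pose B := C * M0%:R / (e / 2).
have B0 : 0 <= B by apply: divr_ge0; [rewrite mulr_ge0// ltW|rewrite divr_ge0// ltW].
have [ks [u s h]] := lists (Num.bound B).
have := archi_boundP B0; set M := Num.bound B in s *.
rewrite ltr_pdivrMr ?divr_gt0// => hB.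
have le1 : M%:R * e <= f (Z ks).
  rewrite fZ -s; elim: ks {s u} h => [|k ks IH] h; first by rewrite mul0r big_nil.
  rewrite big_cons /= -natr1 mulrDl mul1r addrC lerD ?h ?mem_head//.
  by apply: IH => l lks; apply: h; rewrite inE lks orbT.
have le2 : f (Z ks) <= C * (M0%:R + M%:R * (e / (2 * C))).
  apply: (le_trans (ler_norm _)); apply: (le_trans (fC _ (ZX ks))).
  apply: ler_wpM2l; first exact: ltW.
  apply: normX_le => [|i].
    by rewrite addr_ge0// mulr_ge0// divr_ge0 ?mulr_ge0// ltW.
  apply: (le_trans (nZ _ u i)); rewrite s; apply: (le_trans (wpart_le_split i M0 M)).
  by rewrite lerD2l ler_wpM2l.
have := le_trans le1 le2; rewrite mulrDr.
have -> : C * (M%:R * (e / (2 * C))) = M%:R * (e / 2) by field; rewrite gt_eqF.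
move: hB; set X := M%:R; set Y := C * _; lra.
Qed.

End MaxLorentzNorm.

(** * Realizing the model norms, and the structure of a weakly null sequence *)

Section SpreadingModels.
Variables (R : realType) (n : nat) (w : nat -> nat -> R).
Hypothesis sw : forall i, submult_weight (w i).
Implicit Types (A B : {set 'I_n}) (i : 'I_n).

Let hw i := submult_weight_decreasing (sw i).

Lemma resid_diag A (y : E R n) (a : nat -> R) M i j :
  resid y a (diag_unit R A) M i j =
  y i j - (if (i \in A) && (j < M)%N then a j else 0).
Proof.
rewrite /resid /diag_unit; congr (_ - _); case: (i \in A) => /=; last first.
  by rewrite big1// => l _; rewrite mulr0.
case: ltnP => jM.
  rewrite (bigD1 (Ordinal jM))//= eqxx mulr1 big1 ?addr0// => l lj.
  case: eqP => E; rewrite ?mulr0//; case/eqP: lj; exact/val_inj.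
by rewrite big1// => l _; rewrite gtn_eqF ?mulr0// (leq_trans (ltn_ord l)).
Qed.

Lemma inX_resid (y : E R n) (a : nat -> R) (x : nat -> E R n) M :
  inX w y -> (forall k, inX w (x k)) -> inX w (resid y a x M).
Proof.
move=> fy fx; rewrite (_ : resid y a x M =
    fun i j => -1 * (\sum_(m < M) a m * x m i j) + y i j); last first.
  by apply/funext => i; apply/funext => j; rewrite /resid mulN1r addrC.
exact: (@inX_lin _ n _ sw (-1) _ _ (inX_sum sw M a fx) fy).
Qed.

(** A vector in the closed span has equal components on [A] and vanishes off [A], so its
    coefficients can only be the entries of the component [y i0] with [i0] in [A]. *)
Lemma basic_diag A : A != finset.set0 -> basic w (diag_unit R A).
Proof.
move=> /set0Pn[i0 i0A] y fy app.
have rX a M := inX_resid a M fy (inX_diag_unit sw A).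
have yE i j : y i j = if i \in A then y i0 j else 0.
  apply/eqP; rewrite -subr_eq0 -normr_le0; apply/ler_addgt0Pr => e e0; rewrite add0r.
  have [|M [b hb]] := app (e / 2); first by rewrite divr_gt0.
  have h1 := coord_le_normX sw i j (rX b M).
  have h2 := coord_le_normX sw i0 j (rX b M).
  rewrite !resid_diag i0A /= in h1 h2.
  case: (i \in A) h1 => /= h1; last by lra.
  set c := (if _ then _ else _) in h1 h2.
  have := ler_normB (y i j - c) (y i0 j - c).
  have -> : y i j - c - (y i0 j - c) = y i j - y i0 j by ring.
  lra.
exists (y i0); split.
  (* Beyond the length [M0] of an approximating combination, the residual of the expansion is
     dominated coordinatewise by the residual of that combination. *)
  apply/cvgr0Pnorm_lt => e e0; have [M0 [b hb]] := app e e0.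
  exists M0 => // M /= M0M; rewrite ger0_norm ?normX_ge0//; apply: le_lt_trans hb.
  apply: normX_le; first exact: normX_ge0.
  move=> i; apply: le_trans (lnorm_le_normX w _ i).
  apply: (ler_lnorm (hw i) (rX b M0 i) _).2 => j; rewrite !resid_diag yE.
  case: (i \in A) => /=; last by rewrite subrr.
  case: ltnP => [jM|jM]; first by rewrite subrr normr0.
  by rewrite ltnNge (leq_trans M0M jM).
move=> a /cvgr0Pnorm_lt ha; apply/funext => j; apply/eqP; rewrite -subr_eq0 -normr_le0.
apply/ler_addgt0Pr => e e0; rewrite add0r; have [M _ hM] := ha e e0.
have := hM (maxn M j.+1) (leq_maxl _ _) => /=.
rewrite ger0_norm ?normX_ge0// => /ltW; apply: le_trans.
have := coord_le_normX sw i0 j (rX a (maxn M j.+1)).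
by rewrite resid_diag i0A leq_maxr.
Qed.

Lemma is_SPw_maxnorm A : A != finset.set0 -> is_SPw n w (maxnorm w A).
Proof.
move=> A0; exists (diag_unit R A); split.
- exact: inX_diag_unit.
- by move=> k; exact: normX_diag_unit.
- exact: basic_diag.
- exact: weakly_null_diag.
- exists (normed_poly (maxnorm_poly_norm sw A0)), (fun m => 'X^m); split.
    exact: generates_diag.
  exact: smnorm_monomials.
Qed.

Section WeaklyNullSequence.
Variable x : nat -> E R n.
Hypotheses (fx : forall k, inX w (x k)) (nx : forall k, normX w (x k) = 1)
  (wnx : weakly_null w x).

Lemma lnorm_le1 k (i : 'I_n) : lnorm (w i) (x k i) <= 1.
Proof. by rewrite -(nx k); exact: lnorm_le_normX. Qed.

(* [A] is minimal among the sets off which the components are small infinitely often. *)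
Lemma essential_support : exists A (d : R), [/\ A != finset.set0, 0 < d &
  forall (e : R) K, 0 < e -> exists k, [/\ (K <= k)%N,
    forall i : 'I_n, i \notin A -> lnorm (w i) (x k i) < e &
    forall i : 'I_n, i \in A -> d <= lnorm (w i) (x k i)]].
Proof.
pose Q A := forall (e : R) K, 0 < e -> exists k, (K <= k)%N /\
  forall i : 'I_n, i \notin A -> lnorm (w i) (x k i) < e.
have QT : exists A, `[< Q A >].
  by exists (finset.setTfor 'I_n); apply/asboolP => e K _; exists K; split=> // i; rewrite inE.
have [A /minsetP[/asboolP QA Amin]] := ex_minset QT.
(* By minimality, [A] without [i] fails the smallness property: from stage [p.2] on, component [i]
   or one outside [A] has norm at least [p.1]. *)
have /choice[f hf] : forall i : 'I_n, exists p : R * nat, i \in A -> 0 < p.1 /\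
    forall k, (p.2 <= k)%N -> exists i' : 'I_n,
      (i' == i) || (i' \notin A) /\ p.1 <= lnorm (w i') (x k i').
  move=> i; have [iA|_] := boolP (i \in A); last by exists (0, 0%N).
  apply: contrapT => no; have : `[< Q (A :\ i)%SET >].
    apply/asboolP => e K e0; apply: contrapT => no'; apply: no.
    exists (e, K) => _; split=> // k Kk; apply: contrapT => no2; apply: no'.
    exists k; split=> // i' hi'; rewrite ltNge; apply/negP => le; apply: no2.
    by exists i'; split=> //; move: hi'; rewrite finset.in_setD1 negb_and negbK.
  move=> /Amin/(_ (finset.subsetDl _ _)) E; by have := finset.in_setD1 i A i; rewrite E iA eqxx.
pose d := \big[Num.min/1]_(i in A) (f i).1.
have d0 : 0 < d by apply: lt_bigmin => // i iA; have [] := hf i iA.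
exists A, d; split=> //.
  apply/negP => /eqP A0; have [|k [_ hk]] := QA (1 / 2) 0%N; first by lra.
  have : normX w (x k) <= 1 / 2.
    by apply: normX_le => [|i]; [lra|apply/ltW/hk; rewrite A0 inE].
  by rewrite nx; lra.
(* Making the components outside [A] smaller than [d] as well leaves only component [i] itself as
   the large one. *)
move=> e K e0; have [|k [Kk hk]] := QA (Num.min e d) (maxn K (\max_(i < n) (f i).2)).
  by rewrite lt_min e0.
move: Kk; rewrite geq_max => /andP[Kk fk].
exists k; split=> // [i iA|i iA]; first by have := hk i iA; rewrite lt_min => /andP[].
have dle : d <= (f i).1 by exact: (bigmin_le_cond _ (fun i => (f i).1)).
have [_ hfi] := hf i iA; have fik : ((f i).2 <= k)%N.
  by apply: leq_trans fk; exact: (@leq_bigmax _ (fun i => (f i).2) i).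
have [i' [/orP[/eqP ->|i'A] le]] := hfi k fik; first exact: le_trans dle le.
 have := hk i' i'A; rewrite lt_min => /andP[_ lt].
by have := lt_le_trans lt (le_trans dle le); rewrite ltxx.
Qed.

Lemma uniform_tail (e : R) : 0 < e -> exists N K, forall (i : 'I_n) k, (K <= k)%N ->
  forall F, uniq F -> wsum (w i) (x k i) N F <= e.
Proof.
move=> e0.
have /choice[f hf] : forall i : 'I_n, exists p : nat * nat, forall k, (p.2 <= k)%N ->
    forall F, uniq F -> wsum (w i) (x k i) p.1 F <= e.
  move=> i; have [N [K h]] := weakly_null_tail i sw fx wnx e0.
  by exists (N, K).
exists (\max_(i < n) (f i).1)%N, (\max_(i < n) (f i).2)%N => i k hk F uF.
apply: (@le_trans _ _ (wsum (w i) (x k i) (f i).1 F)).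
  by apply: (wsum_shift (hw i)); exact: (@leq_bigmax _ (fun i => (f i).1) i).
by apply: hf => //; apply: leq_trans hk; exact: (@leq_bigmax _ (fun i => (f i).2) i).
Qed.

(** If every coordinate were below [d / 4 / N.+1], the first [N] ranks would give at most [d / 4]
    and the uniform tail at most [d / 2], less than [d] in all. *)
Lemma large_coord (d : R) : 0 < d -> exists (h : R) K, 0 < h /\
  forall (i : 'I_n) k, (K <= k)%N -> d <= lnorm (w i) (x k i) -> exists j, h <= `|x k i j|.
Proof.
move=> d0; have [|N [K hK]] := @uniform_tail (d / 2); first by rewrite divr_gt0.
exists (d / 4 / N.+1%:R), K; split; first by rewrite !divr_gt0.
move=> i k Kk dk; apply: contrapT => no.
suff : lnorm (w i) (x k i) <= N%:R * (d / 4 / N.+1%:R) + d / 2.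
  apply/negP; rewrite -ltNge; apply: lt_le_trans dk.
  have : N%:R * (d / 4 / N.+1%:R) <= d / 4.
    rewrite mulrCA ler_piMr ?divr_ge0 ?(ltW d0)//.
    by rewrite ler_pdivrMr// mul1r ler_nat.
  set X := N%:R * _; lra.
apply: (lnorm_le (hw i)) => F uF.
apply: (wsum_split_bound (hw i) uF); first by rewrite !divr_ge0// ltW.
  by move=> j _; rewrite leNgt; apply/negP => /ltW lt; apply: no; exists j.
by move=> G uG; exact: hK.
Qed.

End WeaklyNullSequence.
End SpreadingModels.

(** * Combinatorial selection of subsequences *)

Lemma infinite_pigeonhole (T : finType) (col : nat -> T) (P : nat -> Prop) :
  (forall K, exists k, (K <= k)%N /\ P k) ->
  exists c, forall K, exists k, [/\ (K <= k)%N, P k & col k = c].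
Proof.
move=> inf; apply: contrapT => no.
have /choice[f hf] : forall c, exists K, forall k, (K <= k)%N -> P k -> col k <> c.
  move=> c; apply: contrapT => noc; apply: no; exists c => K.
  apply: contrapT => noK; apply: noc; exists K => k Kk Pk ck; apply: noK.
  by exists k.
have [k [hk Pk]] := inf (\max_(c : T) f c)%N.
by apply: (hf (col k) k _ Pk) => //; apply: leq_trans hk; exact: leq_bigmax.
Qed.

(** Each new term is taken beyond the stage from which its set avoids the finitely many indices
    already used. *)
Lemma disjoint_selection (G : nat -> seq nat) (P : nat -> Prop) :
  (forall K, exists k, (K <= k)%N /\ P k) ->
  (forall J : seq nat, exists K, forall k, (K <= k)%N -> {in J, forall j, j \notin G k}) ->
  forall m K, exists k : nat -> nat,
    (forall l, (l < m)%N -> (K <= k l)%N /\ P (k l)) /\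
    forall l l', (l < l' < m)%N ->
      (k l < k l')%N /\ {in G (k l), forall j, j \notin G (k l')}.
Proof.
move=> inf esc; elim=> [|m IH] K; first by exists id; split=> // l l'; rewrite ltn0 andbF.
have [k [hP hd]] := IH K.
have [K1 hK1] := esc (flatten [seq G (k l) | l <- iota 0 m]).
have [k' [hk' Pk']] := inf (maxn K (maxn K1 (\max_(l < m) (k l).+1))).
move: hk'; rewrite !geq_max => /and3P[Kk K1k mk].
exists (fun l => if (l < m)%N then k l else k'); split.
  by move=> l _; case: ifP => [/hP//|_].
move=> l l' /andP[ll']; rewrite ltnS leq_eqVlt => /orP[/eqP E|l'm].
  rewrite {l'}E in ll' *; rewrite ll' ltnn; split.
    apply: leq_trans mk.
    exact: (@leq_bigmax _ (fun l : 'I_m => (k l).+1) (Ordinal ll')).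
  move=> j jl; apply: hK1 => //; apply/flattenP; exists (G (k l)) => //.
  by apply/mapP; exists l => //; rewrite mem_iota.
by rewrite l'm (ltn_trans ll' l'm); apply: hd; rewrite ll'.
Qed.

(** * Every spreading model is equivalent to some [maxnorm] *)

Section Equivalence.
Variables (R : realType) (n : nat) (w : nat -> nat -> R).
Hypothesis sw : forall i, submult_weight (w i).
Implicit Types (A B : {set 'I_n}) (i : 'I_n).

Let hw i := submult_weight_decreasing (sw i).

Lemma lnorm_sum_le i m (a : nat -> R) (ys : nat -> nat -> R) (c : R) :
  (forall l, (l < m)%N -> lfinite (w i) (ys l) /\ lnorm (w i) (ys l) <= c) ->
  lnorm (w i) (fun j => \sum_(l < m) a l * ys l j) <= (\sum_(l < m) `|a l|) * c.
Proof.
move=> h; apply: (lnorm_le (hw i)) => F uF.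
rewrite (@eq_wsum _ _ _ (fun j => \sum_(l <- iota 0 m) a l * ys l j)); last first.
  by move=> j _; rewrite sum_iota.
apply: (le_trans (wsum_sum (hw i) _ _ _ _)); rewrite sum_iota mulr_suml.
apply: ler_sum => l _; rewrite wsumZ ler_wpM2l//.
by have [f le] := h l (ltn_ord l); apply: le_trans le; apply: (wsum_le_lnorm (hw i) f).
Qed.

Lemma uniform_wpart (C : R) : exists N, forall i, C < wpart (w i) N.
Proof.
have /choice[f hf] : forall i, exists N, C < wpart (w i) N.
  by move=> i; exact: submult_weight_unbounded.
exists (\max_(i < n) f i)%N => i; apply: (lt_le_trans (hf i)).
by apply: (wpart_le (hw i)); exact: leq_bigmax.
Qed.

Variable x : nat -> E R n.
Hypotheses (fx : forall k, inX w (x k)) (nx : forall k, normX w (x k) = 1)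
  (wnx : weakly_null w x).

Lemma level_sets_escape (t : R) (J : seq nat) : 0 < t ->
  exists K, forall k, (K <= k)%N ->
    {in J, forall j, j \notin flatten [seq level_set (x k i) t | i <- enum 'I_n]}.
Proof.
move=> t0; have /choice[f hf] : forall i, exists K, forall k, (K <= k)%N ->
    {in J, forall j, `|x k i j| < t}.
  by move=> i; exact: weakly_null_coords.
exists (\max_(i < n) f i)%N => k hk j jJ; apply/flattenP => -[_ /mapP[i _ ->]].
rewrite (level_setP (sw i) (fx k i) t0).2 leNgt => /negP; apply.
by apply: hf => //; apply: leq_trans hk; exact: leq_bigmax.
Qed.

(* The level sets of height at least [t] of the components are encoded by their
   sizes, which take finitely many values; [k] is chosen along one value. *)
Lemma homogeneous_selection (t : R) D (P : nat -> Prop) m K : 0 < t ->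
  (forall K, exists k, (K <= k)%N /\ P k) ->
  exists (k : nat -> nat) (c : 'I_n -> nat -> nat),
  [/\ forall l, (l < m)%N -> (K <= k l)%N /\ P (k l),
      forall l l', (l < l' < m)%N -> (k l < k l')%N,
      forall i l q, (l < m)%N -> (q < D)%N ->
        size (level_set (x (k l) i) (q.+1%:R * t)) = c i q &
      forall i l l', (l < m)%N -> (l' < m)%N -> l != l' ->
        {in level_set (x (k l) i) t, forall j, j \notin level_set (x (k l') i) t}].
Proof.
(* Components have norm at most 1, so [1 / t < wpart (w i) N] forces level sets of height at least
   [t] to have fewer than [N] elements. *)
move=> t0 inf; have [N hN] := uniform_wpart (1 / t).
pose sz k i q := size (level_set (x k i) (q.+1%:R * t)).
have szN k i q : (sz k i q < N.+1)%N.
  apply/ltnW; apply: (size_level_set (sw i) (fx k i)); first by rewrite mulr_gt0.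
  apply: (le_lt_trans (lnorm_le1 nx k i)).
  have := hN i; rewrite ltr_pdivrMr// => /lt_le_trans; apply.
  rewrite ler_wpM2l ?(wpart_ge0 (hw i))//.
  by rewrite ler_peMl ?ler1n// ltW.
(* The color of [k] is the table of all its level-set sizes, one of finitely many. *)
pose col k : {ffun 'I_n * 'I_D -> 'I_N.+1} := [ffun p : 'I_n * 'I_D => inord (sz k p.1 p.2)].
have [c hc] := infinite_pigeonhole col inf.
have inf' K' : exists k, (K' <= k)%N /\ (P k /\ col k = c).
  by have [k [? ? ?]] := hc K'; exists k.
have [k [hP hd]] := disjoint_selection inf' (fun J => level_sets_escape J t0) m K.
exists k, (fun i q => sz (k 0%N) i q); split.
- by move=> l /hP[? []].
- by move=> l l' /hd[].
- move=> i l q lm qD; have m0 : (0 < m)%N by apply: leq_ltn_trans lm.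
  have [_ [_ El]] := hP l lm; have [_ [_ E0]] := hP 0%N m0.
  have : col (k l) (i, Ordinal qD) = col (k 0%N) (i, Ordinal qD) by rewrite El E0.
  by rewrite !ffunE => /(congr1 val) /=; rewrite !inordK.
have inG k' i j : j \in level_set (x k' i) t ->
    j \in flatten [seq level_set (x k' i) t | i <- enum 'I_n].
  move=> jL; apply/flattenP; exists (level_set (x k' i) t) => //.
  by apply: map_f; rewrite mem_enum.
move=> i l l' lm lm'; rewrite neq_ltn => /orP[lt|lt] j jl.
  have [_ /(_ j (inG _ _ _ jl))] := hd l l' (introT andP (conj lt lm')).
  by apply: contra; exact: inG.
apply/negP => jl'; have [_ /(_ j (inG _ _ _ jl'))] := hd l' l (introT andP (conj lt lm)).
by rewrite (inG _ _ _ jl).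
Qed.

(** The set [A] and the constants do not depend on [m]. One good choice of [m] terms suffices, since
    a spreading model controls all sufficiently late choices at once. *)
Lemma well_spread_blocks : exists A (h : R), [/\ A != finset.set0, 0 < h &
  forall m, (0 < m)%N -> exists k : nat -> nat,
  [/\ (m <= (k 0%N).+1)%N, forall l l', (l < l' < m)%N -> (k l < k l')%N &
  forall a : seq R, size a = m ->
    normX w (comb a x k) <= 3 * maxnorm w A a /\
    h * maxnorm w A a <= 2 * normX w (comb a x k)]].
Proof.
have [A [d [A0 d0 Ad]]] := essential_support nx.
have [h [K0 [h0 hh]]] := large_coord sw fx wnx d0.
exists A, h; split=> // m m0; have mR : 0 < m%:R :> R by rewrite ltr0n.
pose e : R := 1 / (2 * m%:R); have e0 : 0 < e by rewrite divr_gt0// mulr_gt0.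
have [N [K1 hK1]] := uniform_tail sw fx wnx e0.
(* The first bound gives [m * (N * t) <= 1 / 2], which with [m * e = 1 / 2] meets the condition of
   [block_upper]; the second gives [m * m * t <= h / 2] for [block_lower]. *)
pose t : R := Num.min (1 / (2 * m%:R * N.+1%:R)) (h / (2 * (m%:R * m%:R))).
have t0 : 0 < t by rewrite lt_min !divr_gt0 ?mulr_gt0.
have tN : m%:R * (N%:R * t) <= 1 / 2.
  apply: (@le_trans _ _ (m%:R * (N.+1%:R * t))).
    by rewrite ler_pM2l// ler_pM2r// ler_nat.
  have : t <= 1 / (2 * m%:R * N.+1%:R) by rewrite ge_min lexx.
  rewrite ler_pdivlMr ?mulr_gt0//; lra.
have th2 : m%:R * m%:R * t <= h / 2.
  have : t <= h / (2 * (m%:R * m%:R)) by rewrite ge_min lexx orbT.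
  rewrite ler_pdivlMr ?mulr_gt0//; lra.
have th : t <= h.
  have : t <= m%:R * m%:R * t by rewrite ler_peMl ?(ltW t0)// -natrM ler1n muln_gt0 m0.
  lra.
(* Coordinates are at most 1, so [D] multiples of [t] exhaust all the heights that occur. *)
pose D := Num.bound (1 / t).
have Dt : 1 < D.+1%:R * t.
  have := @archi_boundP R (1 / t); rewrite divr_ge0 ?(ltW t0)// => /(_ isT).
  rewrite ltr_pdivrMr// -/D => /lt_trans; apply.
  by rewrite ltr_pM2r// ltr_nat.
(* Outside [A] the bound [1 / m] makes [m] terms together contribute at most the largest
   coefficient, hence at most [maxnorm w A a]. *)
pose P k := [/\ (maxn K0 K1 <= k)%N,
  forall i, i \notin A -> lnorm (w i) (x k i) < m%:R^-1 &
  forall i, i \in A -> d <= lnorm (w i) (x k i)].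
have inf K : exists k, (K <= k)%N /\ P k.
  have [|k [hk h1 h2]] := Ad m%:R^-1 (maxn K (maxn K0 K1)); first by rewrite invr_gt0.
  by move: hk; rewrite geq_max => /andP[]; exists k.
have [k [c [hP kmon hc hd]]] := @homogeneous_selection t D P m m t0 inf.
exists k; split=> //; first by have [/leqW] := hP 0%N m0.
move=> a sa.
have am j : (m <= j)%N -> a`_j = 0 by move=> mj; rewrite nth_default// sa.
have combE i : comb a x k i = fun j => \sum_(l < m) a`_l * x (k l) i j.
  by rewrite /comb sa.
have combX i : lfinite (w i) (fun j => \sum_(l < m) a`_l * x (k l) i j).
  exact: (inX_sum sw m (fun l => a`_l) (fun l => fx (k l))).
split.
  apply: normX_le; first by rewrite mulr_ge0// maxnorm_ge0.
  move=> i; rewrite combE; have [iA|iA] := boolP (i \in A).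
    apply: (@le_trans _ _ (3 * lnorm (w i) (fun j => a`_j))).
      apply: (block_upper (sw i) m0 am (fun l _ => fx (k l) i) t0 (hd i)
        (e := e) (N := N) (D := D) (c := c i)) => //.
      - by move=> l _; exact: lnorm_le1.
      - move=> l lm F uF; apply: hK1 => //.
        by have [_ [+ _ _]] := hP l lm; rewrite geq_max => /andP[].
      - have -> : m%:R * (N%:R * t + e) = m%:R * (N%:R * t) + 1 / 2.
          by rewrite /e; field; rewrite gt_eqF.
        by lra.
      - by move=> l q; exact: hc.
    by rewrite ler_wpM2l// lnorm_le_maxnorm.
  apply: (le_trans (@lnorm_sum_le i m (fun l => a`_l) (fun l => x (k l) i) m%:R^-1 _)).
    by move=> l lm; split; [exact: fx|have [_ [_ /(_ i iA)/ltW]] := hP l lm].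
  rewrite ler_pdivrMr//; apply: (@le_trans _ _ (\sum_(l < m) maxnorm w A a)).
    by apply: ler_sum => l _; exact: coord_le_maxnorm.
  rewrite sumr_const card_ord -[leLHS]mulr_natr ler_wpM2r//.
  by have := maxnorm_ge0 w A a; lra.
have hmax : maxnorm w A a <= 2 * normX w (comb a x k) / h.
  apply: maxnorm_le; first by rewrite divr_ge0 ?(ltW h0)// mulr_ge0// normX_ge0.
  move=> i iA; rewrite ler_pdivlMr// mulrC.
  have /choice[jj hjj] : forall l, exists j, (l < m)%N -> h <= `|x (k l) i j|.
    move=> l; case: (ltnP l m) => [lm|_]; last by exists 0%N.
    have [_ [+ _ /(_ i iA)]] := hP l lm; rewrite geq_max => /andP[K0k _] dk.
    by have [j hj] := hh i _ K0k dk; exists j.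
  apply: (le_trans (block_lower (sw i) am (fun l _ => fx (k l) i) t0 (hd i) hjj th th2 (combX i))).
  by rewrite ler_wpM2l//; have := lnorm_le_normX w (comb a x k) i; rewrite combE.
by move: hmax; rewrite ler_pdivlMr// mulrC.
Qed.

Lemma smnormZ (V : normedModType R) (xt : nat -> V) (c : R) (a : seq R) :
  smnorm xt [seq c * z | z <- a] = `|c| * smnorm xt a.
Proof.
rewrite /smnorm size_map -normrZ scaler_sumr; congr `| _ |; apply: eq_bigr => l _.
by rewrite (nth_map 0)// scalerA.
Qed.

(** After scaling the coefficients into [[-1, 1]], the terms from [well_spread_blocks] link the
    spreading model norm to [maxnorm]. As [eps] is non-increasing, [1 + eps 0] gives constants valid
    for every length. *)
Lemma spreading_model_equiv (V : normedModType R) (xt : nat -> V) :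
  generates_sm w x xt -> exists A, [/\ A != finset.set0,
    dominates (smnorm xt) (maxnorm w A) & dominates (maxnorm w A) (smnorm xt)].
Proof.
move=> [eps [eps_dec eps0 sm]].
have [A [h [A0 h0 blocks]]] := well_spread_blocks.
have eps_le m : eps m <= eps 0%N.
  by elim: m => // m IH; exact: le_trans (eps_dec m) IH.
have eps_ge0 m : 0 <= eps m.
  rewrite -(cvg_lim (@Rhausdorff R) eps0).
  apply: nonincreasing_cvgn_ge; last by apply/cvg_ex; exists 0.
  by apply/nonincreasing_seqP.
suff key (a : seq R) : (forall m, (m < size a)%N -> `|a`_m| <= 1) ->
    maxnorm w A a <= (2 / h * (1 + eps 0%N)) * smnorm xt a /\
    smnorm xt a <= (1 + eps 0%N) * 3 * maxnorm w A a.
  have scaled (a : seq R) : exists2 c : R, 0 < c &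
      forall m, (m < size [seq (c * z)%R | z <- a])%N -> `|[seq c * z | z <- a]`_m| <= 1.
    (* This divisor bounds every coefficient, and the summand 1 keeps it positive for the zero
       sequence. *)
    pose s : R := 1 + \sum_(l < size a) `|a`_l|.
    have s1 : 1 <= s by rewrite lerDl sumr_ge0.
    have s0 : 0 < s by exact: lt_le_trans s1.
    exists s^-1; first by rewrite invr_gt0.
    rewrite size_map => m ma; rewrite (nth_map 0)// normrM gtr0_norm ?invr_gt0//.
    rewrite ler_pdivrMl// mulr1 /s (bigD1 (Ordinal ma))//= addrCA lerDl addr_ge0//.
    exact: sumr_ge0.
  have mZ (c : R) (a : seq R) : maxnorm w A [seq c * z | z <- a] = `|c| * maxnorm w A a.
    apply: (maxnorm_scale sw) => j; have [ja|ja] := ltnP j (size a).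
      by rewrite (nth_map 0).
    by rewrite !nth_default ?mulr0// size_map.
  exists A; split=> //.
    exists (2 / h * (1 + eps 0%N)) => a; have [c c0 /key[+ _]] := scaled a.
    by rewrite mZ smnormZ gtr0_norm// mulrCA ler_pM2l.
  exists ((1 + eps 0%N) * 3) => a; have [c c0 /key[_ +]] := scaled a.
  by rewrite mZ smnormZ gtr0_norm// mulrCA ler_pM2l.
move=> a1; case: (posnP (size a)) => [/size0nil ->|sa].
  have m0 : maxnorm w A [::] = 0.
    rewrite (maxnorm_scale sw A (c := 0) (a := [::])) ?normr0 ?mul0r// => j.
    by rewrite nth_nil mul0r.
  by rewrite m0 /smnorm big_ord0 normr0 !mulr0.
have [k [k0 kmon /(_ a erefl)[up low]]] := blocks _ sa.
have [lo hi] := sm a k a1 kmon k0.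
set M := maxnorm w A a in up low *; set X := normX w _ in up low lo hi.
set Y := smnorm xt a in lo hi *.
have e1 : 0 < 1 + eps (size a) by rewrite ltr_pwDl// eps_ge0.
have le1 := eps_le (size a); have ge0 := eps_ge0 (size a).
have X0 : 0 <= X by exact: normX_ge0.
have Y0 : 0 <= Y by exact: normr_ge0.
rewrite ler_pdivrMl// in lo.
have eY : 0 <= (eps 0%N - eps (size a)) * Y by rewrite mulr_ge0 ?subr_ge0.
have eX : 0 <= (eps 0%N - eps (size a)) * X by rewrite mulr_ge0 ?subr_ge0.
split.
  rewrite (_ : _ * Y = 2 * ((1 + eps 0%N) * Y) / h); last by ring.
  by rewrite ler_pdivlMr// mulrC (le_trans low)//; lra.
apply: (le_trans lo); rewrite -mulrA.
have := ler_wpM2l (ltW (lt_le_trans e1 (lerD (lexx 1) le1))) up.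
lra.
Qed.

End Equivalence.

(** * The order isomorphism with the nonempty subsets *)

Unset Implicit Arguments. Set Strict Implicit. Set Printing Implicit Defensive.

Theorem theorem2p9 (R : realType) (S : nat -> R -> R)
  (hS : forall i, submultiplicative (S i))
  (hsep : forall (A : seq nat) (j : nat), A != [::] -> j \notin A ->
     forall M : R, exists m : nat,
       (1 <= m)%N /\ M * \big[Num.max/0]_(i <- A) S i m%:R < S j m%:R)
  (hw : forall i, (weight (S i) @ \oo --> (0 : R))%classic)
  (n : nat) (hn : (0 < n)%N) :
  let w := fun i : nat => weight (S i) in
  exists Phi : {set 'I_n} -> (seq R -> R),
    [/\ (forall A : {set 'I_n}, A != finset.set0 -> is_SPw n w (Phi A)),
        (forall N, is_SPw n w N ->
           exists A : {set 'I_n}, [/\ A != finset.set0, dominates N (Phi A) & dominates (Phi A) N])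
      & (forall A B : {set 'I_n}, A != finset.set0 -> B != finset.set0 ->
           (dominates (Phi B) (Phi A) <-> A \subset B))].
Proof.
move=> w.
have S1 i : S i 1 = 1 by have [_ _ _ _ [+ _]] := hS i; apply; apply/andP; split; lra.
have Sge1 i m : (1 <= m)%N -> 1 <= S i m%:R.
  case: m => // -[|m] _; first by rewrite S1.
  have [_ _ Smon _ _] := hS i; rewrite -[leLHS](S1 i) ltW// Smon// ltr1n//.
have sw i : submult_weight (w i).
  apply: submult_weight_of => // M.
  (* Separation from the single function [S i.+1], which is at least 1 at positive integers, shows
     that [S i] is unbounded. *)
  have [|m [m1 lt]] := hsep [:: i.+1] i isT _ `|M|; first by rewrite inE ltn_eqF.
  exists m; split=> //; apply: le_lt_trans lt; rewrite big_cons big_nil.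
  apply: (le_trans (ler_norm M)); rewrite ler_peMr//.
  by rewrite le_max Sge1.
have wpartE i m : (1 <= m)%N -> wpart (w i) m = S i m%:R.
  by case: m => // m _; rewrite wpart_weight.
exists (maxnorm w); split.
- by move=> A; exact: is_SPw_maxnorm.
- by move=> N [x [fx nx _ wnx [V [xt [sm ->]]]]]; exact: (spreading_model_equiv sw fx nx wnx).
move=> A B A0 B0; split=> [[C dom]|AB]; last first.
  by exists 1 => a; rewrite mul1r; exact: maxnormS.
apply/fintype.subsetP => j jA; apply: contraT => jB.
(* If [j] were in [A] but not in [B], the constant sequence of length [m] would have norm at least
   [S j m] for [A] and at most the maximum over [L] of the [S i m] for [B]; separation with the
   factor [|C|] contradicts domination. *)
pose L := [seq val i | i <- enum B].
have [||m [m1 lt]] := hsep L (val j) _ _ `|C|.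
- by apply: contra B0 => /eqP L0; rewrite -cards_eq0 cardE -(size_map val) -/L L0.
- by apply: contra jB => /mapP[i iB /val_inj ->]; rewrite mem_enum in iB.
have := lnorm_le_maxnorm w (nseq m 1) jA; rewrite lnorm_ones// wpartE// => le1.
have le2 : maxnorm w B (nseq m 1) <= \big[Num.max/0]_(i <- L) S i m%:R.
  apply: maxnorm_le; first exact: bigmax_ge_id.
  move=> i iB; rewrite lnorm_ones// wpartE//.
  apply: (le_bigmax_seq 0 (val i) xpredT (fun i => S i m%:R)) => //.
  by apply: map_f; rewrite mem_enum.
have le3 := le_trans le1 (dom (nseq m 1)).
have le4 := ler_wpM2r (maxnorm_ge0 w B (nseq m 1)) (ler_norm C).
have le5 := ler_wpM2l (normr_ge0 C) le2.
by have := le_lt_trans (le_trans le3 (le_trans le4 le5)) lt; rewrite ltxx.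
Qed.
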